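(* Let $\psi(\mathcal{X})=\mathcal{X}$ be an inflation functional equation that has a primitive subdivision matrix $S=[|\mathcal{D}_{ij}|]_{1\le i,j\le n}$. Then the following conditions are equivalent: (i) For some $N>0$ there exists a weak Delone multiset family $\hat{\mathcal{X}}$ satisfying $\psi^N(\hat{\mathcal{X}})=\hat{\mathcal{X}}$. (ii) For some $N>0$ there exists a self-replicating multi-tiling family $\hat{\mathcal{X}}$ for the inflation functional equation of $\psi^N(\cdot)$. (iii) The subdivision matrix $S$ satisfies the Perron eigenvalue condition $\lambda(S)=|\det(A)|$, and the unique compact solution $(T_1,\dots,T_n)$ of the associated multi-tile functional equation consists of sets $T_i$ that have positive Lebesgue measure, $1\le i\le n$, and each $T_i$ is the closure of its interior, $T_i=\overline{T_i^{\circ}}$.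
   Context: Fix integers $d,n\ge 1$, an expanding real $d\times d$ matrix $A$ (all eigenvalues, real or complex, have absolute value $>1$), and finite, possibly empty, sets $\mathcal{D}_{ij}\subset\mathbb{R}^d$ for $1\le i,j\le n$. A multiset $X$ in $\mathbb{R}^d$ is a set $\underline{X}\subset\mathbb{R}^d$ (the underlying set) with a multiplicity function $m_X:\underline{X}\to\mathbb{Z}_{>0}$, extended by $0$ off $\underline{X}$. The multiset union $X\vee Y$ has multiplicity function $m_X+m_Y$. $A(X)$ has multiplicity $m_X(A^{-1}\mathbf{x})$ at $\mathbf{x}$, and $X+\mathcal{D}=\bigvee_{\mathbf{d}\in\mathcal{D}}(X+\mathbf{d})$ (with multiplicity if $\mathcal{D}$ is a multiset). A multiset family is a vector $\mathcal{X}=(X_1,\dots,X_n)$ of multisets in $\mathbb{R}^d$. The inflation operator is $\psi(\mathcal{X})=(X_1',\dots,X_n')$ with $X_i'=\bigvee_{j=1}^n(A(X_j)+\mathcal{D}_{ij})$; $\psi^N$ is its $N$-fold composition, which is the inflation operator with matrix $A^N$ and digit multisets $$\mathcal{D}_{ij}^{N}=\bigvee_{j_1,\dots,j_{N-1}=1}^n(\mathcal{D}_{ij_{N-1}}+A\mathcal{D}_{j_{N-1}j_{N-2}}+\cdots+A^{N-1}\mathcal{D}_{j_1j}).$$ A nonnegative real square matrix is primitive if some power has all entries strictly positive; its Perron eigenvalue $\lambda(\cdot)$ is its positive real simple eigenvalue equal to its spectral radius. The associated multi-tile functional equation is $A(T_i)=\bigcup_{j=1}^n(T_j+\mathcal{D}_{ji})$,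 $1\le i\le n$ (ordinary set union). When $S$ is primitive it has a unique nonempty solution $(T_1,\dots,T_n)$ with all $T_i$ compact, and then all $T_i$ are nonempty; this is ''the unique compact solution''. The multi-tile equation associated with $\psi^N$ is $A^N(T_i)=\bigcup_{j=1}^n(T_j+\underline{\mathcal{D}}_{ji}^N)$. A multiset $X$ is weakly uniformly discrete if there are $r>0$ and a finite $m\ge1$ such that any open ball of radius $r$ contains at most $m$ points of $X$ counted with multiplicity; uniformly discrete if this holds with $m=1$ for some $r>0$; relatively dense if for some finite $R>0$ each closed ball of radius $R$ contains a point of $X$. A weak Delone multiset is one that is weakly uniformly discrete and relatively dense; a Delone set is a multiset that is uniformly discrete (hence an ordinary set) and relatively dense. A weak Delone multiset family for $\psi^N$ is a multiset family fixed by $\psi^N$ with every component a weak Delone multiset. A multiset family $\mathcal{X}$ is a self-replicating multi-tiling family for $\psi^N$ if: (a) $\psi^N(\mathcal{X})=\mathcal{X}$ and each $X_i$ is a Delone set; (b) the multi-tile equation associated with $\psi^N$ has a unique (nonempty compact) solution $(T_1,\dots,T_n)$, and each $T_i$ has positive Lebesgue measure; (c) the sets $\{T_i+\mathbf{x}_i:1\le i\le n,\ \mathbf{x}_i\in X_i\}$ tile $\mathbb{R}^d$, i.e. they cover $\mathbb{R}^d$ and any two of them with distinct indices $(i,\mathbf{x}_i)$ intersect in a set of Lebesgue measure zero. *)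

(* Defs.v *)
From HB Require Import structures.
From mathcomp Require Import all_boot all_order all_algebra finmap.
From mathcomp Require Import all_classical all_reals all_analysis.
From mathcomp Require Import complex.

Set Implicit Arguments.
Unset Strict Implicit.
Unset Printing Implicit Defensive.

Import Order.TTheory GRing.Theory Num.Theory.
Import numFieldNormedType.Exports.

Local Open Scope classical_set_scope.
Local Open Scope ring_scope.

(** * Matrices *)

Definition complex_eigenvalue (R : realType) (k : nat) (M : 'M[R]_k) (z : R[i]) : bool :=
  eigenvalue (map_mx (real_complex R) M) z.

Definition expanding (R : realType) (d : nat) (A : 'M[R]_d) : Prop :=
  forall z : R[i], complex_eigenvalue A z -> 1 < Normc.normc z.

Definition spectral_radius (R : realType) (k : nat) (M : 'M[R]_k) : R :=
  sup [set Normc.normc z | z in [set z : R[i] | complex_eigenvalue M z]].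

(* The exponent is positive: the zeroth power would make every 1 x 1 matrix
   primitive. *)
Definition primitive (R : realType) (n : nat) (S : 'M[R]_n) : Prop :=
  (forall i j, 0 <= S i j) /\
  exists k : nat, (0 < k)%N /\ forall i j, 0 < (S ^+ k) i j.

(* Simplicity is meant algebraically: a root of multiplicity one of the
   characteristic polynomial. *)
Definition is_perron_eigenvalue (R : realType) (n : nat) (S : 'M[R]_n) (l : R) : Prop :=
  [/\ 0 < l, eigenvalue S l, mup l (char_poly S) = 1%N & l = spectral_radius S].

(** * Euclidean balls and Lebesgue measure in dimension d *)

(* The norm which the library puts on matrices is the sup norm; it induces the
   Euclidean topology, but not the Euclidean balls. *)
Definition enorm (R : realType) (d : nat) (x : 'cV[R]_d) : R :=
  Num.sqrt (\sum_(i < d) x i 0 ^+ 2).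

Definition open_eball (R : realType) (d : nat) (c : 'cV[R]_d) (r : R) : set 'cV[R]_d :=
  [set x | enorm (x - c) < r].

Definition closed_eball (R : realType) (d : nat) (c : 'cV[R]_d) (r : R) : set 'cV[R]_d :=
  [set x | enorm (x - c) <= r].

Definition box (R : realType) (d : nat) (a b : 'cV[R]_d) : set 'cV[R]_d :=
  [set x | forall i, a i 0 < x i 0 <= b i 0].

Definition box_cover (R : realType) (d : nat) (E : set 'cV[R]_d)
    (a b : nat -> 'cV[R]_d) : Prop :=
  (forall k i, a k i 0 <= b k i 0) /\ E `<=` \bigcup_k box (a k) (b k).

(* Lebesgue outer measure, which is Lebesgue measure on measurable sets, in
   particular on compact sets.  It vanishes exactly on the sets of Lebesgue
   measure zero. *)
Definition lebesgue_d (R : realType) (d : nat) (E : set 'cV[R]_d) : \bar R :=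
  ereal_inf [set (\sum_(0 <= k <oo) (\prod_(i < d) (ab.2 k i 0 - ab.1 k i 0))%:E)%E
            | ab in [set ab : (nat -> 'cV[R]_d) * (nat -> 'cV[R]_d)
                    | box_cover E ab.1 ab.2]].

(** * Multisets *)

(* A multiset is its multiplicity function, extended by 0 off the underlying
   set. *)
Definition multiset (R : realType) (d : nat) : Type := 'cV[R]_d -> nat.

Definition mimage (R : realType) (d : nat) (A : 'M[R]_d) (X : multiset R d) : multiset R d :=
  fun x => X (invmx A *m x).

Definition mtranslates (R : realType) (d : nat) (X : multiset R d)
    (D : {fset 'cV[R]_d}) : multiset R d :=
  fun x => (\sum_(e <- D) X (x - e)%R)%N.

Definition inflation (R : realType) (d n : nat) (A : 'M[R]_d)
    (D : 'I_n -> 'I_n -> {fset 'cV[R]_d}) (X : 'I_n -> multiset R d) :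
    'I_n -> multiset R d :=
  fun i x => (\sum_(j < n) mtranslates (mimage A (X j)) (D i j) x)%N.

Definition subdivision_matrix (R : realType) (d n : nat)
    (D : 'I_n -> 'I_n -> {fset 'cV[R]_d}) : 'M[R]_n :=
  \matrix_(i, j) (#|` D i j|)%:R.

(* Number of points of X in B, counted with multiplicity. *)
Definition npoints (R : realType) (d : nat) (X : multiset R d) (B : set 'cV[R]_d) : \bar R :=
  (\esum_(x in B) (X x)%:R%:E)%E.

Definition at_most_in_balls (R : realType) (d : nat) (X : multiset R d) (r : R) (m : nat) : Prop :=
  forall c : 'cV[R]_d, (npoints X (open_eball c r) <= m%:R%:E)%E.

Definition weakly_uniformly_discrete (R : realType) (d : nat) (X : multiset R d) : Prop :=
  exists r : R, exists m : nat, [/\ 0 < r, (1 <= m)%N & at_most_in_balls X r m].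

Definition uniformly_discrete (R : realType) (d : nat) (X : multiset R d) : Prop :=
  exists r : R, 0 < r /\ at_most_in_balls X r 1.

Definition relatively_dense (R : realType) (d : nat) (X : multiset R d) : Prop :=
  exists r : R, 0 < r /\
    forall c : 'cV[R]_d, exists x, closed_eball c r x /\ (0 < X x)%N.

Definition weak_delone (R : realType) (d : nat) (X : multiset R d) : Prop :=
  weakly_uniformly_discrete X /\ relatively_dense X.

Definition delone (R : realType) (d : nat) (X : multiset R d) : Prop :=
  uniformly_discrete X /\ relatively_dense X.

Definition weak_delone_family (R : realType) (d n : nat) (A : 'M[R]_d)
    (D : 'I_n -> 'I_n -> {fset 'cV[R]_d}) (N : nat) (X : 'I_n -> multiset R d) : Prop :=
  iter N (inflation A D) X = X /\ forall i, weak_delone (X i).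

(** * Multi-tile equations *)

(* The digit multiset of the N-th iterate, listed with repetitions.  It is the
   union over the index paths i = p 0, p 1, ..., p N = j (p k is the index
   j_{N-k} of the usual formula) of the sums
   D_{p 0 p 1} + A D_{p 1 p 2} + ... + A^{N-1} D_{p (N-1) p N}. *)
Definition iterated_digits (R : realType) (d n : nat) (A : 'M[R]_d)
    (D : 'I_n -> 'I_n -> {fset 'cV[R]_d}) (N : nat) (i j : 'I_n) : seq 'cV[R]_d :=
  \big[cat/[::]]_(p : {ffun 'I_N.+1 -> 'I_n} | (p ord0 == i) && (p ord_max == j))
    \big[(fun s t => [seq x + y | x <- s, y <- t])/[:: 0]]_(k < N)
      [seq A ^+ k *m e | e <- D (p (inord k)) (p (inord k.+1))].

Definition multitile_equation (R : realType) (d n : nat) (A : 'M[R]_d)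
    (D : 'I_n -> 'I_n -> set 'cV[R]_d) (T : 'I_n -> set 'cV[R]_d) : Prop :=
  forall i, [set A *m x | x in T i] =
            \bigcup_(j in [set: 'I_n]) [set x + e | x in T j & e in D j i].

(* A family is nonempty when its components are not all empty. *)
Definition compact_solution (R : realType) (d n : nat) (A : 'M[R]_d)
    (D : 'I_n -> 'I_n -> set 'cV[R]_d) (T : 'I_n -> set 'cV[R]_d) : Prop :=
  [/\ multitile_equation A D T, exists i, T i !=set0 & forall i, compact (T i)].

Definition unique_compact_solution (R : realType) (d n : nat) (A : 'M[R]_d)
    (D : 'I_n -> 'I_n -> set 'cV[R]_d) (T : 'I_n -> set 'cV[R]_d) : Prop :=
  compact_solution A D T /\
  forall T', compact_solution A D T' -> forall i, T' i = T i.

Definition translate (R : realType) (d : nat) (T : set 'cV[R]_d) (x : 'cV[R]_d) : set 'cV[R]_d :=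
  [set t + x | t in T].

Definition tiles_space (R : realType) (d n : nat) (T : 'I_n -> set 'cV[R]_d)
    (X : 'I_n -> multiset R d) : Prop :=
  (forall y : 'cV[R]_d, exists i x, (0 < X i x)%N /\ translate (T i) x y) /\
  (forall i x j y, (0 < X i x)%N -> (0 < X j y)%N -> (i, x) <> (j, y) ->
     lebesgue_d (translate (T i) x `&` translate (T j) y) = 0%E).

Definition self_replicating_multitiling (R : realType) (d n : nat) (A : 'M[R]_d)
    (D : 'I_n -> 'I_n -> {fset 'cV[R]_d}) (N : nat) (X : 'I_n -> multiset R d) : Prop :=
  [/\ iter N (inflation A D) X = X,
      forall i, delone (X i)
    & exists T : 'I_n -> set 'cV[R]_d,
      [/\ unique_compact_solution (A ^+ N)
            (fun i j => [set` iterated_digits A D N i j]) T,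
          forall i, (0 < lebesgue_d (T i))%E
        & tiles_space T X]].

(* Main.v *)
Require Import Defs.
From HB Require Import structures.
From mathcomp Require Import all_boot all_order all_algebra finmap.
From mathcomp Require Import all_classical all_reals all_analysis.
From mathcomp Require Import complex perm ring lra zify.

Import Order.TTheory GRing.Theory Num.Theory.
Import numFieldNormedType.Exports.

Local Open Scope classical_set_scope.
Local Open Scope ring_scope.

Set Implicit Arguments.
Unset Strict Implicit.
Unset Printing Implicit Defensive.

(** The matrix [A^-1] contracts, so the multi-tile equation has one nonempty
   compact solution [T]: [T i] consists of the points whose successive expansions,
   corrected by digits, stay bounded.  Expanding [k] times cuts [A^k (T i)]
   into the pieces [T j + e], with [e] in the digit multiset of the [k]-th
   iterate, and inflating a point [x] of type [i] produces exactly the points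
   [A^k x + e] at which the pieces of the expanded tile [A^k (T i + x)] sit.
   Everything rests on comparing the measures of the pieces with the measure of
   the expanded tile.  With [tau i] the measure of [T i] and [l = |det A|],
   subadditivity gives [l tau <= tau S], and equality says that the pieces of
   an expanded tile overlap in null sets only.

   From a weak Delone family [X] fixed by [psi^N] to the tiles.  The union of
   the sets [T i + x], for [x] in [X i], is invariant under [A^N] and leaves
   bounded gaps; contracting by powers of [A^-N] shows that it is dense.  It is a
   locally finite union of closed sets, so some tile has an interior point;
   by primitivity small copies of this tile are everywhere dense in all tiles,
   hence each tile is the closure of its interior and has positive measure
   ([tiles_closure_interior]).  Weak uniform discreteness bounds the
   multiplicity of the covering of [A^(kN) (T i + x)] by its pieces uniformly in
   [k], so [tau S^(kN)] grows at most like [l^(kN)].  Since [S] is primitive, an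
   excess in [l tau <= tau S] would force a larger rate of growth
   ([subinvariant_growth]).  Therefore [tau S = l tau]
   ([tile_measures_invariant]), and a positive invariant vector of a primitive
   matrix belongs to its Perron eigenvalue ([perron_of_positive_invariant]).

   From the tiles to a self-replicating multi-tiling.  If [l] is the spectral
   radius of [S], the same growth argument gives [tau S = l tau], so pieces do not
   overlap.  A piece of type [i0] deep inside an expanded tile of type [i0]
   yields [N] and a point [x0] such that the tile at [x0] is one of the pieces of
   its own [N]-th expansion and lies in its interior
   ([self_reproducing_tile]).  The patches [psi^(kN)] of this single tile then
   increase to a family which is fixed by [psi^N], covers the space and has no
   overlaps; interior points of the tiles and primitivity make its components
   Delone sets.  A self-replicating multi-tiling family is in particular a weak
   Delone family, which closes the circle.

   The measure used here is an outer measure defined by coverings with boxes in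
   any dimension.  The facts needed about it are proved first: closed sets are
   measurable ([caratheodory_closed]), a linear map multiplies it by the absolute
   value of its determinant ([lebesgue_d_linear]), and balls have positive
   measure ([lebesgue_d_ball_gt0]).  The contraction property of [A^-1] and the
   growth estimates for [S] both follow from the fact that the powers of a
   matrix are governed by its spectrum ([powers_small_spectrum]). *)

(** * Powers of a matrix and its spectrum *)

Lemma cvg0_affine_recursion (R : realType) (q : R) (a b : nat -> R) :
  0 <= q < 1 -> (forall k, 0 <= a k) -> (forall k, a k.+1 <= q * a k + b k) ->
  b @ \oo --> 0 -> a @ \oo --> 0.
Proof.
move=> /andP[q0 q1] a0 ab b0.
apply/cvgrPdist_le => /= e e0.
have e20 : 0 < (1 - q) * (e / 2) by rewrite mulr_gt0 ?subr_gt0 ?divr_gt0.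
move/cvgrPdist_le : b0 => /(_ _ e20) [K _ HK].
have aK j : a (K + j)%N <= q ^+ j * a K + e / 2.
  elim: j => [|j IH]; first by rewrite addn0 expr0 mul1r lerDl ltW ?divr_gt0.
  rewrite addnS; apply: (le_trans (ab _)).
  have := HK (K + j)%N (leq_addr _ _); rewrite sub0r normrN => /(le_trans (ler_norm _)) bj.
  apply: (le_trans (lerD (ler_wpM2l q0 IH) bj)).
  by rewrite exprS le_eqVlt; apply/orP; left; apply/eqP; ring.
have : (fun j => q ^+ j * a K) @ \oo --> (0 * a K).
  by apply: cvgM; [apply: cvg_expr; rewrite ger0_norm|exact: cvg_cst].
rewrite mul0r => /cvgrPdist_le /(_ (e / 2)); rewrite divr_gt0 // => /(_ isT)[L _ HL].
exists (K + L)%N => // k /= Kk.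
rewrite sub0r normrN ger0_norm //.
have -> : k = (K + (k - K))%N by rewrite subnKC // (leq_trans _ Kk) // leq_addr.
apply: (le_trans (aK _)).
have := HL (k - K)%N; rewrite /= sub0r normrN => /(_ _)/(le_trans (ler_norm _)) h.
rewrite [leRHS](splitr e) lerD2r h //.
by rewrite leq_subRL // (leq_trans _ Kk) // leq_addr.
Qed.

Lemma normc_real_complex (R : rcfType) (x : R) : Normc.normc (real_complex R x) = `|x|.
Proof. by rewrite /Normc.normc /= expr0n /= addr0 sqrtr_sqr. Qed.

Lemma normc_ge0 (R : rcfType) (z : R[i]) : 0 <= Normc.normc z.
Proof. by case: z => a b /=; exact: sqrtr_ge0. Qed.

(** By Cayley-Hamilton a product of factors [M - z] over the eigenvalues [z]
   kills the sequence of powers; each factor is a first order recursion of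
   ratio [z], so the factors can be removed one at a time. *)
Lemma powers_small_spectrum (R : realType) (n : nat) (M : 'M[R]_n) (rho : R) :
  0 < rho -> (forall z, complex_eigenvalue M z -> Normc.normc z < rho) ->
  forall i j, (fun m => (M ^+ m) i j / rho ^+ m) @ \oo --> 0.
Proof.
case: n M => [M _ _ []//|n M] rho0 Mrho i j.
set C := map_mx (real_complex R) M.
have H s : (forall z, z \in s -> Normc.normc z < rho) -> forall G : 'M[R[i]]_n.+1,
    horner_mx C (\prod_(z <- s) ('X - z%:P)) *m G = 0 ->
    forall i j, (fun m => Normc.normc ((C ^+ m *m G) i j) / rho ^+ m) @ \oo --> 0.
  elim: s => [|z s IH] sr G.
    rewrite big_nil rmorph1 mul1mx => -> {}i {}j.
    rewrite (_ : (fun _ => _) = fun=> 0); first exact: cvg_cst.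
    by apply/funext => m; rewrite mulmx0 mxE Normc.normc0 mul0r.
  rewrite big_cons mulrC rmorphM -mulmxE -mulmxA rmorphB /= horner_mx_X horner_mx_C => HG {}i {}j.
  have zr : Normc.normc z < rho by apply: sr; rewrite mem_head.
  have sr' z' : z' \in s -> Normc.normc z' < rho by move=> h; apply: sr; rewrite in_cons h orbT.
  have b0 := IH sr' _ HG i j.
  apply: (@cvg0_affine_recursion _ (Normc.normc z / rho) _
    (fun m => Normc.normc ((C ^+ m *m ((C - z%:M) *m G)) i j) / rho ^+ m / rho)).
  - by rewrite divr_ge0 ?normc_ge0 ?(ltW rho0) //= ltr_pdivrMr // mul1r.
  - by move=> k; rewrite divr_ge0 ?normc_ge0 ?exprn_ge0 ?(ltW rho0).
  - move=> k; rewrite exprSr -mulmxE -mulmxA.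
    have -> : C *m G = (C - z%:M) *m G + z *: G by rewrite mulmxBl mul_scalar_mx subrK.
    rewrite mulmxDr -scalemxAr mxE [X in _ + X]mxE.
    have -> : Normc.normc z / rho * (Normc.normc ((C ^+ k *m G) i j) / rho ^+ k) +
      Normc.normc ((C ^+ k *m ((C - z%:M) *m G)) i j) / rho ^+ k / rho =
      (Normc.normc ((C ^+ k *m ((C - z%:M) *m G)) i j) + Normc.normc z * Normc.normc ((C ^+ k *m G) i j)) / rho ^+ k.+1.
      by rewrite exprS; field; rewrite !lt0r_neq0 // exprn_gt0.
    rewrite ler_pM2r ?invr_gt0 ?exprn_gt0 // -Normc.normcM.
    exact: le_normcD.
  - by rewrite -(mul0r rho^-1); apply: cvgM => //; exact: cvg_cst.
have [s Hs] := closed_field_poly_normal (char_poly C).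
move: Hs; rewrite (monicP (char_poly_monic C)) scale1r => Hs.
have sr z : z \in s -> Normc.normc z < rho.
  move=> zs; apply: Mrho; rewrite /complex_eigenvalue -/C eigenvalue_root_char Hs.
  by rewrite root_prod_XsubC.
have := H s sr 1%:M; rewrite -Hs Cayley_Hamilton mul0mx => /(_ erefl i j) h.
apply: norm_cvg0.
suff -> : (fun m => `|(M ^+ m) i j / rho ^+ m|) =
   (fun m => Normc.normc ((C ^+ m *m 1%:M) i j) / rho ^+ m) by [].
apply/funext => m; rewrite mulmx1 -rmorphXn /= mxE normc_real_complex normrM.
by rewrite [X in _ * X]ger0_norm // invr_ge0 exprn_ge0 // ltW.
Qed.

(** * A norm adapted to an expanding matrix *)

Lemma ler_col_norm (R : realType) (d : nat) (x : 'cV[R]_d) (r : R) :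
  0 <= r -> (`|x| <= r) <-> (forall i, `|x i 0| <= r).
Proof.
move=> r0; rewrite [X in X <= r]/Num.norm /= mx_normrE; split.
  by move=> /bigmax_leP[_ /= H] i; apply: (H (i, 0)).
by move=> H; apply/bigmax_leP; split=> // -[i j] _ /=; rewrite ord1.
Qed.

Lemma entry_le_norm (R : realType) (d : nat) (x : 'cV[R]_d) i : `|x i 0| <= `|x|.
Proof. by move: i; apply/ler_col_norm. Qed.

Lemma mulmx_entry_norm (R : realType) (d : nat) (M : 'M[R]_d) (e : R) (x : 'cV[R]_d) :
  0 <= e -> (forall i j, `|M i j| <= e) -> `|M *m x| <= d%:R * e * `|x|.
Proof.
move=> e0 Me; apply/ler_col_norm; first by rewrite !mulr_ge0.
move=> i; rewrite mxE; apply: (le_trans (ler_norm_sum _ _ _)).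
apply: (@le_trans _ _ (\sum_(j < d) e * `|x|)).
  by apply: ler_sum => j _; rewrite normrM ler_pM ?entry_le_norm.
by rewrite sumr_const card_ord -mulrA mulr_natl.
Qed.

Lemma mulmx_bounded (R : realType) (d : nat) (M : 'M[R]_d) :
  exists C : R, 0 < C /\ forall x : 'cV[R]_d, `|M *m x| <= C * `|x|.
Proof.
set e := \sum_i \sum_j `|M i j|.
have e0 : 0 <= e by apply: sumr_ge0 => i _; apply: sumr_ge0.
exists (d%:R * e + 1); split; first by rewrite ltr_wpDl // mulr_ge0.
move=> x; apply: (@le_trans _ _ (d%:R * e * `|x|)).
  apply: mulmx_entry_norm => // i j; rewrite /e (bigD1 i) //= (bigD1 j) //= -addrA lerDl.
  by rewrite addr_ge0 //; apply: sumr_ge0 => // k _; apply: sumr_ge0.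
by rewrite mulrDl mul1r lerDl.
Qed.

Lemma expanding_unitmx (R : realType) (d : nat) (A : 'M[R]_d) :
  expanding A -> A \in unitmx.
Proof.
move=> hA; rewrite -(map_unitmx (real_complex R)) -row_free_unit -kermx_eq0.
apply/negPn/negP => k0.
have /hA : complex_eigenvalue A 0.
  by rewrite /complex_eigenvalue /eigenvalue /eigenspace raddf0 subr0.
by rewrite Normc.normc0 ltr10.
Qed.

Lemma complex_eigenvalue_invmx (R : realType) (d : nat) (A : 'M[R]_d) (z : R[i]) :
  A \in unitmx -> complex_eigenvalue (invmx A) z ->
  z != 0 /\ complex_eigenvalue A z^-1.
Proof.
move=> uA; have uC : map_mx (real_complex R) A \in unitmx by rewrite map_unitmx.
move=> /eigenvalueP[v]; rewrite map_invmx => vz v0.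
have z0 : z != 0.
  apply/eqP => z0; move: vz; rewrite z0 scale0r => /(congr1 (mulmx^~ (map_mx (real_complex R) A))).
  by rewrite mulmxKV // mul0mx => v00; rewrite v00 eqxx in v0.
split=> //; apply/eigenvalueP; exists v => //.
move: vz => /(congr1 (mulmx^~ (map_mx (real_complex R) A))).
rewrite mulmxKV // -scalemxAl => {2}->.
by rewrite scalerA mulVf // scale1r.
Qed.

(** Summing the norms of the first iterates of [A^-1], up to one that halves
   the norm, gives an equivalent norm for which [A^-1] itself contracts. *)
Lemma expanding_adapted_norm (R : realType) (d : nat) (A : 'M[R]_d) :
  expanding A ->
  exists (q : 'cV[R]_d -> R) (c C : R),
    [/\ 0 < c < 1, 0 < C,
        forall x y, q (x + y) <= q x + q y /\ q (- x) = q x,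
        forall x, `|x| <= q x <= C * `|x|
      & forall x, q (invmx A *m x) <= c * q x].
Proof.
move=> hA; have uA := expanding_unitmx hA.
set B := invmx A.
have Bz z : complex_eigenvalue B z -> Normc.normc z < 1.
  move=> /(complex_eigenvalue_invmx uA)[z0 /hA]; rewrite Normc.normcV invf_gt1 //.
  rewrite lt_neqAle normc_ge0 andbT eq_sym.
  by apply: contra z0 => /eqP/Normc.eq0_normc ->.
have [p p0 Bp] : exists2 p, (0 < p)%N & forall x : 'cV_d, `|B ^+ p *m x| <= 2^-1 * `|x|.
  have d0 : 0 < (2 * d.+1%:R)^-1 :> R by rewrite invr_gt0 mulr_gt0.
  have : \forall m \near \oo, forall i j, `|(B ^+ m) i j| <= (2 * d.+1%:R)^-1 :> R.
    apply: filter_forall => i; apply: filter_forall => j.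
    have := powers_small_spectrum ltr01 Bz i j.
    move/cvgrPdist_le => /(_ _ d0); apply: filterS => m.
    by rewrite sub0r normrN expr1n divr1.
  move=> [K _ HK]; exists K.+1 => // x.
  have H := HK K.+1 (leqnSn _).
  apply: (le_trans (mulmx_entry_norm x (ltW d0) H)); apply: ler_wpM2r => //.
  rewrite invfM mulrCA -[leRHS]mulr1 ler_wpM2l ?invr_ge0 //.
  by rewrite ler_pdivrMr // mul1r ler_nat.
pose q (x : 'cV[R]_d) := \sum_(l < p) `|B ^+ l *m x|.
have qge x : `|x| <= q x.
  rewrite /q -(prednK p0) big_ord_recl expr0 mul1mx lerDl.
  by apply: sumr_ge0.
have [C [C1 qC]] : exists C, 1 <= C /\ forall x, q x <= C * `|x|.
  have HC (l : 'I_p) : {Cl : R | 0 < Cl /\ forall x : 'cV_d, `|B ^+ l *m x| <= Cl * `|x|}.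
    exact/cid/mulmx_bounded.
  exists (1 + \sum_l sval (HC l)); split.
    by rewrite lerDl sumr_ge0 // => l _; case: (HC l) => /= Cl [/ltW].
  move=> x; apply: (@le_trans _ _ (\sum_l sval (HC l) * `|x|)).
    by apply: ler_sum => l _; case: (HC l) => /= Cl [].
  by rewrite -mulr_suml ler_wpM2r // lerDr.
have C0 : 0 < C by rewrite (lt_le_trans _ C1).
(* An application of [B] replaces the summand [|x|] of [q x] by
   [|B ^+ p *m x|], a loss of at least [|x| / 2], which is at least
   [q x / (2 * C)]. *)
exists q, (1 - (2 * C)^-1), C; split => //.
- apply/andP; split.
    by rewrite subr_gt0 invf_lt1 ?mulr_gt0 // (@lt_le_trans _ _ 2) ?ltr1n // -[leLHS]mulr1 ler_wpM2l.
  by rewrite ltrBlDr ltrDl invr_gt0 mulr_gt0.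
- move=> x y; split.
    rewrite /q -big_split; apply: ler_sum => l _; rewrite mulmxDr; exact: ler_normD.
  by apply: eq_bigr => l _; rewrite mulmxN normrN.
- by move=> x; rewrite qge qC.
- move=> x.
  have -> : q (B *m x) = q x - `|x| + `|B ^+ p *m x|.
    have h l : B ^+ l *m (B *m x) = B ^+ l.+1 *m x by rewrite mulmxA exprSr.
    rewrite /q; under eq_bigr do rewrite h.
    move: p0 {Bp q qge qC}; case: p => // p _.
    rewrite [in LHS]big_ord_recr [in RHS]big_ord_recl /= expr0 mul1mx.
    by rewrite [X in _ = X + _]addrAC subrr add0r.
  rewrite mulrBl mul1r.
  have h1 := Bp x.
  have h2 : (2 * C)^-1 * q x <= 2^-1 * `|x|.
    by rewrite invfM -mulrA ler_wpM2l ?invr_ge0 // mulrC ler_pdivrMr // mulrC.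
  have h3 : `|x| = 2^-1 * `|x| + 2^-1 * `|x| by field.
  lra.
Qed.

(** * Perron-Frobenius theory of primitive matrices *)

Lemma char_poly_similar (F : fieldType) (n : nat) (P S B : 'M[F]_n) :
  P \in unitmx -> P *m S = B *m P -> char_poly S = char_poly B.
Proof.
move=> uP PS.
have e : map_mx polyC P *m char_poly_mx S = char_poly_mx B *m map_mx polyC P.
  rewrite /char_poly_mx mulmxBr mulmxBl -!map_mxM PS; congr (_ - _).
  by rewrite mul_mx_scalar mul_scalar_mx.
have := congr1 determinant e; rewrite !det_mulmx [RHS]mulrC.
apply: mulfI; rewrite det_map_mx polyC_eq0.
by move: uP; rewrite unitmxE unitfE.
Qed.

Lemma mulmx_gt0 (R : realType) (n : nat) (S T : 'M[R]_n) :
  (forall i j, 0 < S i j) -> (forall i j, 0 < T i j) -> forall i j, 0 < (S *m T) i j.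
Proof.
move=> S0 T0 i j; rewrite mxE (bigD1 i) //= ltr_pwDl ?mulr_gt0 //.
by apply: sumr_ge0 => k _; rewrite mulr_ge0 // ltW.
Qed.

(** Primitivity provides one positive power; its multiples are positive too, so
   a positive power may be sought among the multiples of any exponent. *)
Lemma primitive_expr_mul (R : realType) (n : nat) (S : 'M[R]_n) k N :
  (0 < N)%N -> (forall i j, 0 < (S ^+ k) i j) -> forall i j, 0 < (S ^+ (N * k)) i j.
Proof.
move=> N0 Sk; rewrite mulnC exprM; case: N N0 => // N _.
elim: N => [|N IH]; first by rewrite expr1.
by rewrite exprS; apply: mulmx_gt0.
Qed.

(** A positive subinvariant vector that is not invariant becomes, after an
   application of a positive power of [S], strictly subinvariant in every
   entry, and then grows at a rate larger than [l]. *)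
Lemma subinvariant_growth (R : realType) (n : nat) (S : 'M[R]_n) (l : R) (t : 'rV[R]_n) :
  primitive S -> (forall j, 0 < t 0 j) -> 0 < l ->
  (forall j, l * t 0 j <= (t *m S) 0 j) -> t *m S <> l *: t ->
  exists (rho c : R) (m0 : nat), [/\ l < rho, 0 < c &
    forall m j, (m0 <= m)%N -> c * rho ^+ m <= (t *m S ^+ m) 0 j].
Proof.
move=> [S0 [k [k0 Sk]]] t0 l0 tS tne.
have [j0 j0P] : exists j0, l * t 0 j0 < (t *m S) 0 j0.
  apply: contrapT => H; apply: tne; apply/rowP => j; rewrite [RHS]mxE; apply/eqP.
  rewrite eq_le tS andbT leNgt; apply/negP => h; apply: H; by exists j.
set y := t *m S ^+ k.
have y0 j : 0 < y 0 j.
  rewrite mxE (bigD1 j0) //= ltr_pwDl ?mulr_gt0 // sumr_ge0 // => i _.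
  by rewrite mulr_ge0 // ltW.
have yS j : l * y 0 j < (y *m S) 0 j.
  have -> : (y *m S) 0 j = ((t *m S) *m S ^+ k) 0 j by rewrite -!mulmxA; congr ((_ *m _) _ _); rewrite -[LHS]exprSr -[RHS]exprS.
  rewrite !mxE mulr_sumr -subr_gt0 -sumrB (bigD1 j0) //= ltr_pwDl //.
    by rewrite mulrA -mulrBl mulr_gt0 // subr_gt0.
  by apply: sumr_ge0 => i _; rewrite mulrA -mulrBl mulr_ge0 ?subr_ge0 // ltW.
have [rho [rl rP]] : exists rho, l < rho /\ forall j, rho * y 0 j <= (y *m S) 0 j.
  have : \forall e \near 0^'+, forall j, (l + e) * y 0 j <= (y *m S) 0 j.
    apply: filter_forall => j; near=> e.
    rewrite mulrDl -lerBrDl -ler_pdivlMr //.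
    near: e; apply: nbhs_right_le; by rewrite divr_gt0 // subr_gt0.
  move=> H; near (0:R)^'+ => e; exists (l + e); split; first by rewrite ltrDl; near: e; exact: nbhs_right_gt.
  by near: e.
have rho0 : 0 < rho by rewrite (lt_trans l0).
have ym m j : rho ^+ m * y 0 j <= (y *m S ^+ m) 0 j.
  elim: m j => [|m IH] j; first by rewrite !expr0 mul1r mulmx1.
  rewrite exprSr -mulrA; apply: (le_trans (ler_wpM2l _ (rP j))); first by rewrite exprn_ge0 ?ltW.
  rewrite exprSr mulmxA !mxE mulr_sumr; apply: ler_sum => i _.
  by rewrite mulrA ler_wpM2r.
have [ymin ymin0 yminP] : exists2 e : R, 0 < e & forall j, e <= y 0 j.
  have : \forall e \near 0^'+, forall j, e <= y 0 j.
    by apply: filter_forall => j; near=> e; near: e; apply: nbhs_right_le.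
  move=> H; near (0:R)^'+ => e; exists e; first by near: e; exact: nbhs_right_gt.
  by near: e.
exists rho, (ymin / rho ^+ k), k; split => //; first by rewrite divr_gt0 ?exprn_gt0.
move=> m j km.
have -> : t *m S ^+ m = y *m S ^+ (m - k).
  by rewrite -mulmxA; congr (_ *m _); rewrite -[RHS]exprD subnKC.
apply: (le_trans _ (ym _ _)).
rewrite -[in leLHS](subnKC km) exprD mulrA divfK ?lt0r_neq0 ?exprn_gt0 // mulrC.
by rewrite ler_wpM2l // exprn_ge0 // ltW.
Unshelve. all: by end_near.
Qed.

Lemma char_poly_tr (F : comNzRingType) (n : nat) (M : 'M[F]_n) :
  char_poly M^T = char_poly M.
Proof.
rewrite /char_poly -det_tr; congr (\det _).
by rewrite /char_poly_mx raddfB /= tr_scalar_mx map_trmx trmxK.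
Qed.

(** A positive power of [S] spreads one nonzero entry to all entries. *)
Lemma nonneg_eigenvector_gt0 (R : realType) (n : nat) (S : 'M[R]_n) (l : R) (v : 'cV[R]_n) :
  primitive S -> 0 < l -> S *m v = l *: v -> (forall i, 0 <= v i 0) -> v != 0 ->
  forall i, 0 < v i 0.
Proof.
move=> [_ [k [_ Sk]]] l0 Sv v0 vn0 i.
have e m : S ^+ m *m v = l ^+ m *: v.
  elim: m => [|m IH]; first by rewrite !expr0 mul1mx scale1r.
  by rewrite exprS -[_ * _]/(_ *m _) -mulmxA IH -scalemxAr Sv scalerA -exprSr.
have [j vj] : exists j, v j 0 != 0.
  apply: contrapT => H; move: vn0; rewrite -(negbK (v == 0)) => /negP; apply; apply/negPn/eqP/colP => j.
  by rewrite mxE; apply/eqP/negPn/negP => h; apply: H; exists j.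
have : 0 < (S ^+ k *m v) i 0.
  rewrite mxE (bigD1 j) //= ltr_pwDl //; first by rewrite mulr_gt0 // lt0r vj v0.
  by apply: sumr_ge0 => h _; rewrite mulr_ge0 // ltW.
by rewrite e mxE pmulr_rgt0 // exprn_gt0.
Qed.

(** Pairing with [t] turns the inequality [l |u| <= S |u|] into an equality, so
   that [|u| + u] and [|u| - u] are nonnegative eigenvectors.  Being orthogonal
   to [t], [u] differs from [|u|] and [- |u|] unless it vanishes; both vectors
   are then positive everywhere, although their entrywise product is zero. *)
Lemma eigenvector_orthogonal_eq0 (R : realType) (n : nat) (S : 'M[R]_n) (l : R)
    (t : 'rV[R]_n) (u : 'cV[R]_n) :
  primitive S -> (forall j, 0 < t 0 j) -> 0 < l -> t *m S = l *: t ->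
  S *m u = l *: u -> t *m u = 0 -> u = 0.
Proof.
move=> pS t0 l0 tS Su tu; have [S0 _] := pS.
pose a : 'cV[R]_n := \col_i `|u i 0|.
have aE i : a i 0 = `|u i 0| by rewrite mxE.
have Sage i : l * a i 0 <= (S *m a) i 0.
  have : `|(l *: u) i 0| <= (S *m a) i 0.
    rewrite -Su !mxE; apply: (le_trans (ler_norm_sum _ _ _)); apply: ler_sum => j _.
    by rewrite normrM aE (ger0_norm (S0 _ _)).
  by rewrite mxE normrM aE gtr0_norm.
have Sa : S *m a = l *: a.
  have : (t *m (S *m a - l *: a)) 0 0 = 0.
    by rewrite mulmxBr mulmxA tS -scalemxAl -scalemxAr subrr mxE.
  rewrite mxE => /eqP; rewrite psumr_eq0 => [/allP H|i _]; last first.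
    by rewrite mulr_ge0 ?(ltW (t0 _)) // !mxE subr_ge0; have := Sage i; rewrite !mxE.
  apply/colP => i; have := H i; rewrite mem_index_enum => /(_ isT) /=.
  rewrite mulf_eq0 gt_eqF //= => /eqP; rewrite [X in X = 0]mxE [X in _ + X]mxE => /eqP.
  by rewrite subr_eq0 => /eqP.
apply: contrapT => /eqP un0.
have [i0 ui0] : exists i, u i 0 != 0.
  apply: contrapT => H; move/negP: un0; apply; apply/eqP/colP => i; rewrite mxE.
  by apply/eqP/negPn/negP => h; apply: H; exists i.
have ta : 0 < (t *m a) 0 0.
  rewrite mxE (bigD1 i0) //= ltr_pwDl //.
    by rewrite mulr_gt0 // aE normr_gt0.
  by apply: sumr_ge0 => i _; rewrite aE mulr_ge0 // ltW.
have pos (s : R) : `|s| = 1 -> forall i, 0 < (a + s *: u) i 0.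
  move=> s1; apply: (nonneg_eigenvector_gt0 pS l0).
  - by rewrite mulmxDr -scalemxAr Sa Su scalerDr !scalerA mulrC.
  - move=> i; rewrite mxE [X in _ + X]mxE aE -lerBlDr sub0r.
    by rewrite (le_trans (ler_norm _)) // normrN normrM s1 mul1r.
  - apply/eqP => z; move: ta; have := congr1 (mulmx t) z.
    rewrite mulmxDr -scalemxAr tu scaler0 addr0 mulmx0 => ->.
    by rewrite mxE ltxx.
have := pos 1 (normr1 _) i0; have := pos (-1) _ i0.
rewrite normrN1 => /(_ erefl).
rewrite !mxE; have [h|h] := leP 0 (u i0 0).
  by rewrite ger0_norm // mulN1r subrr ltxx.
by rewrite ltr0_norm // mul1r addNr ltxx.
Qed.

Lemma normc_sum (R : realType) (I : Type) (r : seq I) (F : I -> R[i]) :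
  Normc.normc (\sum_(i <- r) F i) <= \sum_(i <- r) Normc.normc (F i).
Proof.
elim: r => [|i r IH]; first by rewrite !big_nil Normc.normc0.
by rewrite !big_cons (le_trans (le_normcD _ _)) // lerD2l.
Qed.

(** Pairing with the positive left eigenvector [t] the entrywise inequality
   [|z| |u| <= S |u|], for a right eigenvector [u], compares [|z|] with [l]. *)
Lemma normc_eigenvalue_le (R : realType) (n : nat) (S : 'M[R]_n) (l : R) (t : 'rV[R]_n) :
  (forall i j, 0 <= S i j) -> (forall j, 0 < t 0 j) -> t *m S = l *: t ->
  forall z, complex_eigenvalue S z -> Normc.normc z <= l.
Proof.
move=> S0 t0 tS z; rewrite /complex_eigenvalue eigenvalue_root_char -char_poly_tr.
rewrite -eigenvalue_root_char => /eigenvalueP[u uS un0].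
pose a i := Normc.normc (u 0 i).
have [i0 ui0] : exists i, u 0 i != 0.
  apply: contrapT => H; move/negP: un0; apply; apply/eqP/rowP => i; rewrite mxE.
  by apply/eqP/negPn/negP => h; apply: H; exists i.
have a0 i : 0 <= a i by exact: normc_ge0.
have ta : 0 < \sum_i t 0 i * a i.
  rewrite (bigD1 i0) //= ltr_pwDl //.
    rewrite mulr_gt0 // lt_neqAle a0 andbT eq_sym.
    by apply: contra ui0 => /eqP/Normc.eq0_normc ->.
  by apply: sumr_ge0 => i _; rewrite mulr_ge0 // ltW.
rewrite -(ler_pM2r ta) mulr_sumr.
apply: (@le_trans _ _ (\sum_i t 0 i * \sum_j S i j * a j)).
  apply: ler_sum => i _; rewrite mulrCA ler_wpM2l ?(ltW (t0 i)) //.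
  rewrite -Normc.normcM.
  have -> : z * u 0 i = (z *: u) 0 i by rewrite [RHS]mxE.
  rewrite -uS mxE; apply: (le_trans (normc_sum _ _)).
  apply: ler_sum => j _; rewrite !mxE Normc.normcM mulrC normc_real_complex.
  by rewrite ger0_norm.
under eq_bigr do rewrite mulr_sumr.
rewrite exchange_big /= mulr_sumr; apply: ler_sum => j _.
under eq_bigr do rewrite mulrA.
rewrite -mulr_suml mulrA ler_wpM2r //.
by have := congr1 (fun M : 'rV_n => M 0 j) tS; rewrite !mxE => ->.
Qed.

(** The space orthogonal to the positive vector [t] is invariant and splits off
   one factor of the characteristic polynomial; it contains no eigenvector
   for [l]. *)
Lemma perron_of_positive_invariant (R : realType) (n : nat) (S : 'M[R]_n) (l : R) (t : 'rV[R]_n) :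
  (0 < n)%N -> primitive S -> 0 < l -> (forall j, 0 < t 0 j) -> t *m S = l *: t ->
  is_perron_eigenvalue S l.
Proof.
case: n S t => // m S t _ pS l0 t0 tS; have [S0 _] := pS.
have tn0 : t != 0 by apply/eqP => /rowP/(_ 0); rewrite mxE => h; have := t0 0; rewrite h ltxx.
split => //.
- by apply/eigenvalueP; exists t.
- change 'M[R]_(1 + m) in (type of S); change 'rV[R]_(1 + m) in (type of t).
  (* In a basis whose first covector is [t], the first row of [S] is that of
     [l%:M]. *)
  pose P : 'M[R]_(1 + m) := col_mx t (row_mx 0 1%:M).
  have uP : P \in unitmx.
    rewrite unitmxE unitfE /P -[t]hsubmxK -[col_mx _ _]/(block_mx _ _ _ _) det_ublock det1 mulr1.
    by rewrite det_mx11 mxE; apply/lt0r_neq0.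
  have tP : t *m invmx P = row_mx 1%:M 0.
    have -> : t = row_mx 1%:M 0 *m P by rewrite /P mul_row_col mul1mx mul0mx addr0.
    by rewrite mulmxK.
  have [B PS uB] : exists2 B : 'M[R]_(1 + m), P *m S = B *m P & usubmx B = row_mx l%:M 0.
    exists (P *m S *m invmx P); first by rewrite mulmxKV.
    rewrite -mulmxA -mul_usub_mx /P col_mxKu mulmxA tS -scalemxAl tP scale_row_mx scaler0.
    by rewrite scalemx1.
  have BE : B = block_mx l%:M 0 (dlsubmx B) (drsubmx B).
    by rewrite -[LHS]vsubmxK uB -[dsubmx B in LHS]hsubmxK.
  have cB : char_poly B = ('X - l%:P) * char_poly (drsubmx B).
    rewrite {1}/char_poly /char_poly_mx {1}BE map_block_mx /= map_mx0 (scalar_mx_block _ _ 'X).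
    rewrite opp_block_mx add_block_mx oppr0 addr0 add0r det_lblock; congr (_ * _).
    by rewrite map_scalar_mx /= -raddfB det_scalar expr1.
  rewrite (char_poly_similar uP PS) cB mupM ?polyXsubC_eq0 ?monic_neq0 ?char_poly_monic //.
  rewrite -[X in mup _ X](expr1 ('X - _)) mup_XsubCX eqxx mupNroot ?addn0 //.
  apply/negP; rewrite -char_poly_tr -eigenvalue_root_char => /eigenvalueP[w wD wn0].
  pose u : 'cV[R]_(1 + m) := invmx P *m col_mx 0 w^T.
  have Pu : P *m u = col_mx 0 w^T by rewrite /u mulKVmx.
  have u0 : u = 0.
    apply: (eigenvector_orthogonal_eq0 pS t0 l0 tS).
      have -> : S = invmx P *m (B *m P) by rewrite -PS mulKmx.
      rewrite -!mulmxA Pu {1}BE mul_block_col !mulmx0 mul0mx !add0r.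
      by rewrite -[drsubmx B]trmxK -trmx_mul wD linearZ /= /u scalemxAr scale_col_mx scaler0.
    by rewrite /u mulmxA tP mul_row_col mulmx0 mul0mx addr0.
  move: wn0 Pu; rewrite u0 mulmx0 => /eqP wn0 e; apply: wn0.
  have := congr1 dsubmx e; rewrite col_mxKd linear0 => /(congr1 trmx).
  by rewrite trmxK linear0 => <-.
- apply/eqP; rewrite eq_le; apply/andP; split.
    apply: ub_le_sup.
      by exists l => _ [z /= zS <-]; exact: (normc_eigenvalue_le S0 t0 tS).
    exists (real_complex R l); last by rewrite normc_real_complex gtr0_norm.
    apply/eigenvalueP; exists (map_mx (real_complex R) t).
      by rewrite -map_mxM tS map_mxZ.
    by rewrite map_mx_eq0.
  apply: ge_sup.
    exists (Normc.normc (real_complex R l)), (real_complex R l) => //.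
    apply/eigenvalueP; exists (map_mx (real_complex R) t).
      by rewrite -map_mxM tS map_mxZ.
    by rewrite map_mx_eq0.
  by move=> _ [z /= zS <-]; exact: (normc_eigenvalue_le S0 t0 tS).
Qed.

(** The supremum that defines the spectral radius is over a finite set, the
   roots of the characteristic polynomial, hence it is an upper bound. *)
Lemma complex_eigenvalue_le_spectral_radius (R : realType) (n : nat) (S : 'M[R]_n) z :
  complex_eigenvalue S z -> Normc.normc z <= spectral_radius S.
Proof.
move=> zS; apply: ub_le_sup; last by exists z.
set p := char_poly (map_mx (real_complex R) S).
have [s Hs] := closed_field_poly_normal p.
exists (\sum_(w <- s) Normc.normc w) => _ [w /= wS <-].
have ws : w \in s.
  move: wS; rewrite /complex_eigenvalue eigenvalue_root_char -/p Hs (monicP (char_poly_monic _)) scale1r.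
  by rewrite root_prod_XsubC.
rewrite (big_rem w) //= lerDl; apply: sumr_ge0 => v _; exact: normc_ge0.
Qed.

(** * The outer measure defined by boxes *)

Definition box_volume (R : realType) (d : nat) (a b : 'cV[R]_d) : R :=
  \prod_(i < d) (b i 0 - a i 0).

Section LebesgueOuterMeasure.
Context {R : realType}.
Local Open Scope ereal_scope.

Lemma box_volume_ge0 d (a b : 'cV[R]_d) :
  (forall i, a i 0 <= b i 0)%R -> (0 <= box_volume a b)%R.
Proof. by move=> ab; apply: prodr_ge0 => i _; rewrite subr_ge0. Qed.

Lemma box_volume_diag d (a : 'cV[R]_d) : (0 < d)%N -> box_volume a a = 0%R.
Proof. by case: d a => // d a _; rewrite /box_volume big_ord_recl subrr mul0r. Qed.

Lemma box_cover_series_ge0 d (E : set 'cV[R]_d) a b : box_cover E a b ->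
  0 <= \sum_(0 <= k <oo) (box_volume (a k) (b k))%:E.
Proof. by move=> [ab _]; apply: nneseries_ge0 => k _ _; rewrite lee_fin box_volume_ge0. Qed.

Lemma lebesgue_d_le_boxes d (E : set 'cV[R]_d) a b : box_cover E a b ->
  lebesgue_d E <= \sum_(0 <= k <oo) (box_volume (a k) (b k))%:E.
Proof. by move=> ab; apply: ereal_inf_lbound; exists (a, b). Qed.

Lemma lebesgue_d_ge0 d (E : set 'cV[R]_d) : 0 <= lebesgue_d E.
Proof. by apply: le_ereal_inf_tmp => _ [[a b] /= ab <-]; exact: box_cover_series_ge0 ab. Qed.

Lemma le_lebesgue_d d (E F : set 'cV[R]_d) : E `<=` F -> lebesgue_d E <= lebesgue_d F.
Proof.
move=> EF; apply: ereal_inf_le_tmp => _ [[a b] /= [ab Fab] <-].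
by exists (a, b) => //; split => //=; exact: subset_trans Fab.
Qed.

Lemma lebesgue_d_cover_approx d (E : set 'cV[R]_d) (e : R) :
  lebesgue_d E < +oo -> (0 < e)%R ->
  exists ab : (nat -> 'cV[R]_d) * (nat -> 'cV[R]_d), box_cover E ab.1 ab.2 /\
    \sum_(0 <= k <oo) (box_volume (ab.1 k) (ab.2 k))%:E <= lebesgue_d E + e%:E.
Proof.
move=> Eoo e0; have Efin : lebesgue_d E \is a fin_num.
  by rewrite ge0_fin_numE // lebesgue_d_ge0.
have [_ [ab abE <-] /ltW h] := lb_ereal_inf_adherent e0 Efin.
by exists ab.
Qed.

(** Covers of the [F n], each within a summable error of the infimum, are merged
   into one sequence through a bijection of [nat] with [nat * nat]. *)
Lemma lebesgue_d_sigma_subadditive d (F : nat -> set 'cV[R]_d) :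
  lebesgue_d (\bigcup_n F n) <= \sum_(0 <= i <oo) lebesgue_d (F i).
Proof.
have [[i Fi]|Foo] := pselect (exists i, lebesgue_d (F i) = +oo).
  rewrite (eseries_pinfty _ _ Fi) ?leey // => n _.
  by rewrite -ltNye (lt_le_trans _ (lebesgue_d_ge0 _)).
apply/lee_addgt0Pr => e e0.
rewrite (le_trans _ (epsilon_trick _ _ (ltW e0))) //; last first.
  by move=> n; exact: lebesgue_d_ge0.
have H n : {ab : (nat -> 'cV[R]_d) * (nat -> 'cV[R]_d) | box_cover (F n) ab.1 ab.2 /\
    \sum_(0 <= k <oo) (box_volume (ab.1 k) (ab.2 k))%:E <=
      lebesgue_d (F n) + (e / (2 ^ n.+1)%:R)%:E}.
  apply/cid/lebesgue_d_cover_approx; last by rewrite divr_gt0.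
  by rewrite ltey; apply/eqP => h; apply: Foo; exists n.
pose a n := (sval (H n)).1; pose b n := (sval (H n)).2.
have cov n : box_cover (F n) (a n) (b n) by rewrite /a /b; case: (H n) => ? [].
have bnd n : \sum_(0 <= k <oo) (box_volume (a n k) (b n k))%:E <=
      lebesgue_d (F n) + (e / (2 ^ n.+1)%:R)%:E by rewrite /a /b; case: (H n) => ? [].
pose v n k := (box_volume (a n k) (b n k))%:E.
have v0 n k : 0 <= v n k by rewrite lee_fin box_volume_ge0 //; exact: (cov n).1.
have /card_esym/ppcard_eqP[f] := card_nat2.
have bf : set_bij [set: nat] [set: nat * nat] f by exact: bij.
apply: (@le_trans _ _ (\sum_(0 <= m <oo) v (f m).1 (f m).2)).
  apply: lebesgue_d_le_boxes; split; first by move=> m; exact: (cov _).1.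
  move=> x [n _ /(cov n).2[k _ xk]].
  have [_ _ /(_ (n, k) I)[m _ fm]] := bf.
  by exists m => //=; rewrite fm.
rewrite nneseries_esumT // -(@reindex_esum _ _ _ _ _ _ (fun p => v p.1 p.2) bf).
have -> : [set: nat * nat] = [set: nat] `*`` (fun=> [set: nat]).
  by apply/seteqP; split => // -[].
rewrite -(@esum_esum _ _ _ _ _ v) // -nneseries_esumT; last by move=> n; exact: esum_ge0.
apply: lee_nneseries; first by move=> n _ _; exact: esum_ge0.
by move=> n _; rewrite -nneseries_esumT //; exact: bnd.
Qed.

Lemma lebesgue_d_box d (a b : 'cV[R]_d) : (0 < d)%N -> (forall i, a i 0 <= b i 0)%R ->
  lebesgue_d (box a b) <= (box_volume a b)%:E.
Proof.
move=> d0 ab; pose b' k := if k is 0%N then b else a.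
(* The remaining boxes of the cover are empty. *)
have h : box_cover (box a b) (fun=> a) b'.
  split=> [k i|x xab]; last by exists 0%N.
    by case: k => [|k] /=; [exact: ab|exact: lexx].
apply: (le_trans (lebesgue_d_le_boxes h)).
rewrite nneseries_recl //; last first.
  by move=> k _; rewrite lee_fin box_volume_ge0 // => i; exact: h.1.
rewrite /= eseries_cond /= eseries0 ?adde0 // => -[|k] //= _ _.
by rewrite box_volume_diag.
Qed.

Lemma lebesgue_d0 d : (0 < d)%N -> lebesgue_d (set0 : set 'cV[R]_d) = 0.
Proof.
move=> d0; apply/eqP; rewrite eq_le lebesgue_d_ge0 andbT.
apply: (@le_trans _ _ (lebesgue_d (box (0 : 'cV[R]_d) 0))); first exact: le_lebesgue_d.
apply: (le_trans (lebesgue_d_box d0 _)) => //.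
by rewrite box_volume_diag.
Qed.

HB.instance Definition _ (d : nat) := isOuterMeasure.Build R 'cV[R]_d.+1
  (@lebesgue_d R d.+1) (@lebesgue_d0 d.+1 isT) (@lebesgue_d_ge0 d.+1)
  (@le_lebesgue_d d.+1) (@lebesgue_d_sigma_subadditive d.+1).

Lemma lebesgue_d_bigcup_seq d (I : eqType) (s : seq I) (F : I -> set 'cV[R]_d.+1)
    (E : set 'cV[R]_d.+1) :
  (forall x, E x -> exists2 i, i \in s & F i x) ->
  lebesgue_d E <= \sum_(i <- s) lebesgue_d (F i).
Proof.
elim: s E => [|i s IH] E EF.
  rewrite big_nil -(@lebesgue_d0 d.+1) //; apply: le_lebesgue_d => x /EF [j].
  by rewrite in_nil.
rewrite big_cons.
apply: (@le_trans _ _ (lebesgue_d (F i `|` (E `\` F i)))).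
  by apply: le_lebesgue_d => x Ex; have [h|h] := pselect (F i x); [left|right].
apply: (le_trans (outer_measureU2 (@lebesgue_d R d.+1) _ _)); apply: leeD2l; apply: IH => x [Ex nF].
have [j] := EF _ Ex; rewrite in_cons => /predU1P[->//|js] Fj; by exists j.
Qed.

(** Countable subadditivity reduces a comparison of a set with its image to the
   case of boxes. *)
Lemma lebesgue_d_image_le d (f : 'cV[R]_d -> 'cV[R]_d) (c : R) : (0 < c)%R ->
  (forall a b : 'cV[R]_d, (forall i, a i 0 <= b i 0)%R ->
     lebesgue_d (f @` box a b) <= (c * box_volume a b)%:E) ->
  forall E, lebesgue_d (f @` E) <= c%:E * lebesgue_d E.
Proof.
move=> c0 fb E; rewrite -lee_pdivrMl //.
apply: le_ereal_inf_tmp => _ [[a b] /= [ab cov] <-].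
rewrite lee_pdivrMl //.
apply: (@le_trans _ _ (lebesgue_d (\bigcup_k (f @` box (a k) (b k))))).
  by apply: le_lebesgue_d => _ [x /cov[k _ xk] <-]; exists k => //; exists x.
apply: (le_trans (lebesgue_d_sigma_subadditive _)).
rewrite -nneseriesZl; last by move=> k _; rewrite lee_fin box_volume_ge0.
apply: lee_nneseries; first by move=> k _ _; exact: lebesgue_d_ge0.
by move=> k _; rewrite -EFinM; exact: fb.
Qed.

Lemma lebesgue_d_translate d (x : 'cV[R]_d) (E : set 'cV[R]_d) : (0 < d)%N ->
  lebesgue_d (translate E x) = lebesgue_d E.
Proof.
move=> d0; have le (y : 'cV[R]_d) F : lebesgue_d (translate F y) <= lebesgue_d F.
  rewrite -[leRHS]mul1e; have := @lebesgue_d_image_le d (fun t => t + y)%R 1%R ltr01; apply => a b ab.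
  rewrite mul1r; have -> : box_volume a b = box_volume (a + y) (b + y).
    by apply: eq_bigr => i _; rewrite !mxE opprD addrACA subrr addr0.
  apply: le_trans (lebesgue_d_box d0 _); last by move=> i; rewrite !mxE lerD2r.
  by apply: le_lebesgue_d => _ [z zab <-] i; rewrite !mxE ltrD2r lerD2r.
apply/eqP; rewrite eq_le le /=.
rewrite [in leLHS](_ : E = translate (translate E x) (- x)) ?le //.
apply/seteqP; split => [y Ey|_ [_ [y Ey <-] <-]]; last by rewrite addrK.
by exists (y + x)%R; [exists y|rewrite addrK].
Qed.

End LebesgueOuterMeasure.

(** * Linear images of sets *)

(** This lets the sides of a box grow a little without its volume exceeding a
   prescribed bound. *)
Lemma prod_affine_near_lt (R : realType) (I : finType) (l : I -> R) (k x : R) :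
  \prod_i l i < x -> \forall e \near 0^'+, \prod_i (l i + k * e) < x.
Proof.
move=> lx; apply: (@cvgr_lt _ _ _ _ _ (\prod_i l i)) => //.
apply: cvg_at_right_filter.
have := @cvg_big R I *%R (1 : R) xpredT mul_continuous R (nbhs (0 : R)) (index_enum I)
  (fun i e => l i + k * e) l _; apply => i _.
suff : l i + k * e @[e --> (0 : R)] --> l i + k * 0 by rewrite mulr0 addr0.
by apply: cvgD; [exact: cvg_cst|apply: cvgM; [exact: cvg_cst|exact: cvg_id]].
Qed.

Lemma lee_mul_inf (R : realType) (c : R) (y z : \bar R) : 0 < c -> (0 <= z)%E ->
  (forall x, c < x -> (y <= x%:E * z)%E) -> (y <= c%:E * z)%E.
Proof.
move=> c0; case: z => [z|_ _|//]; last by rewrite gt0_muley ?lte_fin // leey.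
rewrite lee_fin => z0 H; apply/lee_addgt0Pr => e e0.
have z1 : 0 < z + 1 by rewrite ltr_wpDl.
apply: le_trans (H (c + e / (z + 1)) _) _; first by rewrite ltrDl divr_gt0.
rewrite -!EFinM -EFinD lee_fin mulrDl lerD2l mulrAC ler_pdivrMr //.
by rewrite ler_pM2l // lerDl.
Qed.

Section LinearImages.
Context {R : realType} {d : nat}.
Let K := d.+1.
Let V := 'cV[R]_K.

Lemma lebesgue_d_linear_comp (M N : 'M[R]_K) (c c' : R) : 0 < c ->
  (forall E : set V, (lebesgue_d [set M *m x | x in E] <= c%:E * lebesgue_d E)%E) ->
  (forall E : set V, (lebesgue_d [set N *m x | x in E] <= c'%:E * lebesgue_d E)%E) ->
  forall E : set V,
    (lebesgue_d [set (M *m N) *m x | x in E] <= (c * c')%:E * lebesgue_d E)%E.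
Proof.
move=> c0 HM HN E.
apply: le_trans (_ : (lebesgue_d [set M *m x | x in [set N *m x | x in E]] <= _)%E).
  by apply: le_lebesgue_d => _ [x Ex <-]; rewrite -mulmxA; exists (N *m x) => //; exists x.
apply: (le_trans (HM _)); rewrite EFinM -muleA.
by apply: lee_wpmul2l => //; rewrite lee_fin ltW.
Qed.

Lemma lebesgue_d_diag (r : 'rV[R]_K) : (forall i, 0 < r 0 i) ->
  forall E : set V,
    (lebesgue_d [set diag_mx r *m x | x in E] <= (\prod_i r 0 i)%:E * lebesgue_d E)%E.
Proof.
move=> r0; apply: lebesgue_d_image_le; first exact: prodr_gt0.
move=> a b ab.
have e (x : V) i : (diag_mx r *m x) i 0 = r 0 i * x i 0 by rewrite mul_diag_mx mxE.
have -> : (\prod_i r 0 i) * box_volume a b = box_volume (diag_mx r *m a) (diag_mx r *m b).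
  by rewrite /box_volume -big_split /=; apply: eq_bigr => i _; rewrite !e mulrBr.
apply: le_trans (lebesgue_d_box _ _) => //; last by move=> i; rewrite !e ler_pM2l.
apply: le_lebesgue_d => _ [x xab <-] i; rewrite !e ltr_pM2l // ler_pM2l //; exact: xab.
Qed.

Lemma lebesgue_d_perm (s : 'S_K) (E : set V) :
  (lebesgue_d [set perm_mx s *m x | x in E] <= 1%:E * lebesgue_d E)%E.
Proof.
apply: lebesgue_d_image_le => // a b ab; rewrite mul1r.
have e (x : V) i : (perm_mx s *m x) i 0 = x (s i) 0 by rewrite -row_permE mxE.
have -> : box_volume a b = box_volume (perm_mx s *m a) (perm_mx s *m b).
  rewrite /box_volume (reindex_inj (@perm_inj _ s)) /=.
  by apply: eq_bigr => i _; rewrite !e.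
apply: le_trans (lebesgue_d_box _ _) => //; last by move=> i; rewrite !e.
apply: le_lebesgue_d => _ [x xab <-] i; rewrite !e; exact: xab.
Qed.

Definition unit_cube : set V := [set x | forall i, 0 <= x i 0 <= 1].

(** A box is covered by small cubes of total volume arbitrarily close to its
   own, and all cubes are homothetic to the unit cube. *)
Lemma lebesgue_d_linear_le_cube (M : 'M[R]_K) (c : R) : 0 < c ->
  (lebesgue_d [set M *m x | x in unit_cube] <= c%:E)%E ->
  forall E : set V, (lebesgue_d [set M *m x | x in E] <= c%:E * lebesgue_d E)%E.
Proof.
move=> c0 Mc; apply: lebesgue_d_image_le => // a b ab.
have cube (s : R) (p : V) : 0 < s ->
    (lebesgue_d [set M *m (p + s *: x) | x in unit_cube] <= (s ^+ K * c)%:E)%E.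
  move=> s0.
  apply: le_trans (_ : (lebesgue_d (translate [set diag_mx (const_mx s) *m y | y in [set M *m x | x in unit_cube]] (M *m p)) <= _)%E).
    apply: le_lebesgue_d => _ [x xu <-]; exists (s *: (M *m x)); last by rewrite mulmxDr -scalemxAr addrC.
    exists (M *m x); first by exists x.
    by rewrite diag_const_mx mul_scalar_mx.
  rewrite lebesgue_d_translate //; apply: le_trans (lebesgue_d_diag _ _) _; first by move=> i; rewrite mxE.
  have -> : \prod_i (const_mx s : 'rV[R]_K) 0 i = s ^+ K.
    by under eq_bigr do rewrite mxE; rewrite prodr_const card_ord.
  by rewrite EFinM; apply: lee_wpmul2l => //; rewrite lee_fin exprn_ge0 ?ltW.
pose l i := b i 0 - a i 0.
have l0 i : 0 <= l i by rewrite subr_ge0.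
suff H x : \prod_i l i < x -> (lebesgue_d [set M *m y | y in box a b] <= c%:E * x%:E)%E.
  rewrite -[leRHS]mule1 mulrC EFinM -muleA (muleC c%:E); apply/lee_addgt0Pr => e e0.
  have := H (box_volume a b + e / c); rewrite ltrDl divr_gt0 // => /(_ isT) /le_trans; apply.
  rewrite mul1e -!EFinM -EFinD lee_fin mulrDr mulrC lerD2l.
  by rewrite mulrC divfK // lt0r_neq0.
move=> /(prod_affine_near_lt 1) lx.
near (0:R)^'+ => s.
have s0 : 0 < s by near: s; exact: nbhs_right_gt.
have lxs : \prod_i (l i + s) < x.
  have : \prod_i (l i + 1 * s) < x by near: s.
  by under eq_bigr do rewrite mul1r.
pose Nb i := (Num.truncn (l i / s)).+1.
pose N := \max_i Nb i.
pose Q i : pred 'I_N := fun j => (j < Nb i)%N.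
apply: (@le_trans _ _ (\sum_(f <- enum (family Q)) (s ^+ K * c)%:E)%E).
  apply: (le_trans (lebesgue_d_bigcup_seq (s := enum (family Q))
    (F := fun f : {ffun 'I_K -> 'I_N} => [set M *m ((\col_i (a i 0 + s * (f i)%:R)) + s *: y) | y in unit_cube]) _)).
    move=> _ [y yab <-].
    have yi0 i : 0 <= (y i 0 - a i 0) / s.
      by rewrite divr_ge0 ?(ltW s0) // subr_ge0 ltW //; have /andP[] := yab i.
    have fN i : (Num.truncn ((y i 0 - a i 0) / s)%R < Nb i)%N.
      rewrite ltnS; apply: le_truncn; rewrite ler_pM2r ?invr_gt0 // lerD2r.
      by have /andP[] := yab i.
    have fN' i : (Num.truncn ((y i 0 - a i 0) / s)%R < N)%N.
      by apply: (leq_trans (fN i)); exact: leq_bigmax.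
    exists [ffun i => Ordinal (fN' i)].
      by rewrite mem_enum; apply/familyP => i; rewrite ffunE; exact: fN.
    exists (\col_i ((y i 0 - a i 0) / s - (Num.truncn ((y i 0 - a i 0) / s))%:R)).
      move=> i; rewrite mxE; have /andP[h1 h2] := truncn_itv (yi0 i).
      by rewrite subr_ge0 h1 /= lerBlDl -natr1 in h2 *; rewrite addrC ltW // addrC.
    congr (_ *m _); apply/colP => i; rewrite !mxE ffunE /=.
    by field; exact: lt0r_neq0.
  by apply: lee_sum => f _; exact: cube.
rewrite big_enum sumEFin -EFinM lee_fin -mulr_suml mulrC ler_pM2l //.
apply: (@le_trans _ _ (\sum_(f in family Q) \prod_(i < K) s)).
  by under [leRHS]eq_bigr do rewrite prodr_const card_ord.
rewrite -(bigA_distr_big_dep Q (fun _ _ => s)); apply: le_trans (ltW lxs).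
apply: ler_prod => i _; apply/andP; split; first by apply: sumr_ge0 => j _; exact: ltW.
rewrite sumr_const.
have -> : #|[pred j | Q i j]| = Nb i.
  rewrite -[RHS]card_ord.
  have le : (Nb i <= N)%N by exact: leq_bigmax.
  have wi : injective (widen_ord le) by move=> u v /(congr1 val) /= h; exact/val_inj.
  rewrite -(card_imset _ wi); apply: eq_card => j.
  rewrite inE; apply/idP/imsetP => [h|[k _ ->]]; last by rewrite /Q /= ltn_ord.
  by exists (Ordinal h) => //; apply/val_inj.
rewrite /Nb -mulr_natl -natr1 mulrDl mul1r lerD2r -ler_pdivlMr //.
by have /andP[] : (Num.truncn (l i / s))%:R <= l i / s < (Num.truncn (l i / s)).+1%:R
  by apply: truncn_itv; rewrite divr_ge0 // ltW.
Unshelve. all: by end_near.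
Qed.
End LinearImages.

Section DeterminantScaling.
Context {R : realType} {d : nat}.
Let K := d.+1.
Let V := 'cV[R]_K.

(** The image of the unit cube lies in a box whose sides are nearly the
   absolute values of the diagonal entries. *)
Lemma lebesgue_d_near_diagonal (M : 'M[R]_K) (e : R) : 0 < e ->
  (forall i j, i != j -> `|M i j| <= e) ->
  (lebesgue_d [set M *m x | x in @unit_cube R d] <=
     (\prod_i (`|M i i| + 3 * K%:R * e))%:E)%E.
Proof.
move=> e0 Me.
(* The lower bound is lowered twice as much as needed, because boxes do not
   contain their lower faces. *)
pose lo : V := \col_i (Num.min 0 (M i i) - 2 * K%:R * e).
pose hi : V := \col_i (Num.max 0 (M i i) + K%:R * e).
have Ke : 0 < K%:R * e by rewrite mulr_gt0.
have len i : hi i 0 - lo i 0 = `|M i i| + 3 * K%:R * e.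
  by rewrite !mxE; case: (lerP 0 (M i i)) => h; rewrite ?(ger0_norm h) ?(ltr0_norm h); ring.
rewrite (_ : \prod_i _ = box_volume lo hi); last by apply: eq_bigr => i _; rewrite len.
apply: le_trans (lebesgue_d_box _ _) => //; last first.
  by move=> i; rewrite -subr_ge0 len addr_ge0 // !mulr_ge0 // ltW.
apply: le_lebesgue_d => _ [x xu <-] i.
have : `|(M *m x) i 0 - M i i * x i 0| <= K%:R * e.
  rewrite mxE (bigD1 i) //= addrAC subrr add0r; apply: (le_trans (ler_norm_sum _ _ _)).
  apply: (@le_trans _ _ (\sum_(j < K) e)); last by rewrite sumr_const card_ord mulr_natl.
  rewrite [leRHS](bigD1 i) //=; apply: ler_wpDl; first exact: ltW.
  apply: ler_sum => j ij.
  have /andP[xj0 xj1] := xu j.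
  by rewrite normrM (ger0_norm xj0) -[leRHS]mulr1 ler_pM // Me // eq_sym.
have /andP[xi0 xi1] := xu i.
rewrite !mxE ler_distl => /andP[h1 h2].
have [m0|m0] := lerP 0 (M i i).
  have h3 : 0 <= M i i * x i 0 by rewrite mulr_ge0.
  have h4 : M i i * x i 0 <= M i i by rewrite ler_piMr.
  by apply/andP; split; rewrite ?mxE; lra.
have h3 : M i i * x i 0 <= 0 by rewrite mulr_le0_ge0 // ltW.
have h4 : M i i <= M i i * x i 0 by rewrite ler_niMr // ltW.
by apply/andP; split; rewrite ?mxE; lra.
Qed.

(** Conjugation by the diagonal matrix of the powers [s ^ r i], with [s]
   small, shrinks the off-diagonal part of a triangular matrix and leaves its
   diagonal alone; the hypothesis says that [M] is lower triangular for the
   order of the indices given by [r]. *)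
Lemma lebesgue_d_triangular (M : 'M[R]_K) (r : 'I_K -> nat) :
  (forall i j, i != j -> (r i <= r j)%N -> M i j = 0) -> (forall i, M i i != 0) ->
  forall E : set V,
    (lebesgue_d [set M *m x | x in E] <= (\prod_i `|M i i|)%:E * lebesgue_d E)%E.
Proof.
move=> Mr Mi E; apply: lee_mul_inf; [|exact: lebesgue_d_ge0|].
  by apply: prodr_gt0 => i _; rewrite normr_gt0.
move=> x lx; have Hx := prod_affine_near_lt (3 * K%:R) lx.
near (0:R)^'+ => e.
have e0 : 0 < e by near: e; exact: nbhs_right_gt.
have ex : \prod_i (`|M i i| + 3 * K%:R * e) < x by near: e.
pose B := 1 + \sum_i \sum_j `|M i j|.
have B0 : 0 < B by rewrite ltr_wpDr // sumr_ge0 // => i _; apply: sumr_ge0.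
have MB i j : `|M i j| <= B.
  rewrite /B (bigD1 i) //= (bigD1 j) //= addrCA -addrA lerDl.
  by rewrite !addr_ge0 ?sumr_ge0 // => k _; apply: sumr_ge0.
pose s := Num.min 1 (e / B).
have s0 : 0 < s by rewrite lt_min ltr01 divr_gt0.
have s1 : s <= 1 by rewrite ge_min lexx.
have sB : s * B <= e by rewrite -ler_pdivlMr // ge_min lexx orbT.
pose dl : 'rV[R]_K := \row_i s ^+ r i.
pose dv : 'rV[R]_K := \row_i s ^- r i.
have dl0 i : 0 < dl 0 i by rewrite mxE exprn_gt0.
have dv0 i : 0 < dv 0 i by rewrite mxE invr_gt0 exprn_gt0.
have dldv : diag_mx dv *m diag_mx dl = 1%:M.
  apply/matrixP => i j; rewrite mul_diag_mx !mxE; case: eqVneq => [->|_]; last by rewrite mulr0n mulr0.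
  by rewrite mulr1n mulVf // expf_neq0 // lt0r_neq0.
pose W := diag_mx dl *m M *m diag_mx dv.
have WE i j : W i j = s ^+ r i * M i j / s ^+ r j.
  by rewrite /W mul_mx_diag mxE mul_diag_mx !mxE.
have Wi i : W i i = M i i by rewrite WE mulrAC mulfV ?mul1r // expf_neq0 // lt0r_neq0.
have We i j : i != j -> `|W i j| <= e.
  move=> ij; rewrite WE; have [rij|rij] := leqP (r i) (r j).
    by rewrite Mr // mulr0 mul0r normr0 ltW.
  rewrite -(subnKC rij) addSnnS exprD -mulrA mulrC mulrA divfK ?expf_neq0 ?lt0r_neq0 // mulrC.
  rewrite normrM; apply: le_trans sB; rewrite ler_pM // gtr0_norm ?exprn_gt0 //.
  by rewrite exprS ler_piMr ?(ltW s0) // exprn_ile1 // ltW.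
have x0 : 0 < x by rewrite (lt_trans _ lx) // prodr_gt0 // => i _; rewrite normr_gt0.
have HW : forall F : set V, (lebesgue_d [set W *m x | x in F] <= x%:E * lebesgue_d F)%E.
  apply: lebesgue_d_linear_le_cube => //.
  apply: (le_trans (lebesgue_d_near_diagonal e0 We)); rewrite lee_fin ltW //.
  by under eq_bigr do rewrite Wi.
have := @lebesgue_d_linear_comp R d (diag_mx dv) (W *m diag_mx dl) (\prod_i dv 0 i) (x * \prod_i dl 0 i) _
  (lebesgue_d_diag dv0) (lebesgue_d_linear_comp x0 HW (lebesgue_d_diag dl0)) E.
have -> : diag_mx dv *m (W *m diag_mx dl) = M.
  by rewrite /W -!mulmxA dldv mulmx1 mulmxA dldv mul1mx.
rewrite mulrCA -big_split /= [X in x * X]big1 ?mulr1 => [|i _]; last first.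
  by rewrite !mxE mulVf // expf_neq0 // lt0r_neq0.
by apply; apply: prodr_gt0.
Unshelve. all: by end_near.
Qed.

(** By the LUP decomposition it is enough to treat permutations, which map boxes
   to boxes, and the two kinds of triangular matrices. *)
Lemma lebesgue_d_linear_le (M : 'M[R]_K) (E : set V) : M \in unitmx ->
  (lebesgue_d [set M *m x | x in E] <= `|\det M|%:E * lebesgue_d E)%E.
Proof.
move=> uM; have := cormen_lup_correct M; have := cormen_lup_perm M.
have := @cormen_lup_lower _ _ M; have := @cormen_lup_upper _ _ M; have := cormen_lup_detL M.
case: (cormen_lup M) => -[P L] U /= detL upU lowL /is_perm_mxP[s ->] PM.
have detU : \det U = \prod_i U i i.
  rewrite -det_tr det_trig; last by apply/is_trig_mxP => i j ij; rewrite mxE upU.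
  by apply: eq_bigr => i _; rewrite mxE.
have detM : `|\det M| = `|\det U|.
  have := congr1 (fun N => `|\det N|) PM; rewrite -!mulmxE !det_mulmx detL mul1r => <-.
  by rewrite det_perm normrM normrX normrN1 expr1n mul1r.
have ME : M = perm_mx s^-1 *m (L *m U).
  rewrite -[L *m U]PM -mulmxE mulmxA -perm_mxM mulVg perm_mx1 mul1mx.
  by [].
have Ui i : U i i != 0.
  have : \det U != 0 by rewrite -normr_eq0 -detM normr_eq0 -unitfE -unitmxE.
  by rewrite detU prodf_seq_neq0 => /allP/(_ i (mem_index_enum _)).
have HU := @lebesgue_d_triangular U (fun i => d - i)%N _ Ui.
have HL := @lebesgue_d_triangular L val _ _.
rewrite detM detU {1}ME normr_prod -[\prod_i _]mul1r -[X in (X * _)%:E]mul1r -mulrA.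
apply: lebesgue_d_linear_comp => //; first exact: lebesgue_d_perm.
apply: lebesgue_d_linear_comp => // {}E.
  have -> : 1 = \prod_i `|L i i| by rewrite big1 // => i _; rewrite lowL // eqxx normr1.
  apply: HL => [i j ij ij'|i]; last by rewrite lowL // eqxx oner_neq0.
  by rewrite lowL // (negbTE ij).
apply: HU => i j ij ij'; apply: upU.
have := ltn_ord i; have := ltn_ord j; move: ij ij'; rewrite -val_eqE /= /K.
by move: (val i) (val j) => {}i {}j; lia.
Qed.

(** The reverse inequality is the direct one for the inverse matrix. *)
Lemma lebesgue_d_linear (M : 'M[R]_K) (E : set V) : M \in unitmx ->
  lebesgue_d [set M *m x | x in E] = (`|\det M|%:E * lebesgue_d E)%E.
Proof.
move=> uM; apply/eqP; rewrite eq_le lebesgue_d_linear_le //=.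
have dM : 0 < `|\det M| by rewrite normr_gt0 -unitfE -unitmxE.
rewrite -lee_pdivlMl //.
apply: le_trans (_ : (_ <= lebesgue_d [set invmx M *m y | y in [set M *m x | x in E]])%E) _.
  by apply: le_lebesgue_d => x Ex; exists (M *m x); [exists x|rewrite mulKmx].
by rewrite -normrV -?unitmxE // -det_inv; apply: lebesgue_d_linear_le; rewrite unitmx_inv.
Qed.

End DeterminantScaling.

(** * Finite families of measurable sets *)

Section OuterMeasureLists.
Context {R : realType} {T : Type} (mu : {outer_measure set T -> \bar R}).
Local Open Scope ereal_scope.

(** Cutting [E] along the first set of the list lowers the multiplicity of the
   others by one on the part inside it. *)
Lemma caratheodory_sum_le_multiplicity (I : Type) (s : seq I) (F : I -> set T)
    (E : set T) (m : nat) :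
  (forall i, mu.-caratheodory (F i)) ->
  (forall x, E x -> (\sum_(i <- s) `[< F i x >] <= m)%N) ->
  \sum_(i <- s) mu (E `&` F i) <= m%:R%:E * mu E.
Proof.
move=> cF; elim: s E m => [|i s IH] E m Em.
  by rewrite big_nil mule_ge0 // ?lee_fin //; exact: outer_measure_ge0.
have eqE x : E x -> (\sum_(j <- s) `[< F j x >] <= m - `[< F i x >])%N.
  by move=> /Em; rewrite big_cons => h; rewrite leq_subRL // (leq_trans _ h) // leq_addr.
have IH1 : \sum_(j <- s) mu ((E `&` F i) `&` F j) <= m.-1%:R%:E * mu (E `&` F i).
  by apply: IH => x [/eqE]; case: asboolP => //= _; rewrite subn1.
have IH2 : \sum_(j <- s) mu ((E `&` ~` F i) `&` F j) <= m%:R%:E * mu (E `&` ~` F i).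
  by apply: IH => x [/eqE]; case: asboolP => //= _; rewrite subn0.
rewrite big_cons.
have -> : \sum_(j <- s) mu (E `&` F j) =
    \sum_(j <- s) mu ((E `&` F i) `&` F j) + \sum_(j <- s) mu ((E `&` ~` F i) `&` F j).
  by rewrite -big_split /=; apply: eq_bigr => j _; rewrite (cF i (E `&` F j)) (setIAC E (F i)) (setIAC E (~` F i)).
rewrite (cF i E) ge0_muleDr ?outer_measure_ge0 // addeA.
apply: leeD IH2; apply: le_trans (leeD2l _ IH1) _.
case: m Em {IH1 eqE} => [Em|m _].
  have -> : E `&` F i = set0.
    rewrite -subset0 => x [/Em + Fx]; rewrite big_cons.
    by case: asboolP.
  by rewrite outer_measure0 !mule0 adde0.
by rewrite /= -natr1 EFinD ge0_muleDl ?lee_fin // mul1e addeC.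
Qed.

(** An overlap of [F a] and [F b] is counted twice in the sum of the measures and
   once in the measure of the union. *)
Lemma outer_measure_tight_cover_null (I : eqType) (s : seq I) (F : I -> set T)
    (U : set T) (a b : I) (s' : seq I) :
  (forall i, mu.-caratheodory (F i)) -> perm_eq s [:: a, b & s'] ->
  (forall x, U x -> exists2 i, i \in s & F i x) -> mu U < +oo ->
  \sum_(i <- s) mu (F i) <= mu U -> mu (F a `&` F b) = 0.
Proof.
move=> cF sab Us Uoo; rewrite (perm_big _ sab) /= !big_cons => sU.
have mu0 A : 0 <= mu A by exact: outer_measure_ge0.
have sum0 (r : seq I) : 0 <= \sum_(j <- r) mu (F j) by apply: sume_ge0.
have U_le : forall (r : seq I) (V : set T), (forall x, V x -> exists2 i, i \in r & F i x) ->
    mu V <= \sum_(i <- r) mu (F i).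
  elim=> [|i r IH] V Vr.
    rewrite big_nil -(outer_measure0 mu); apply: le_outer_measure => x /Vr [j].
    by rewrite in_nil.
  rewrite big_cons; apply: (@le_trans _ _ (mu (F i `|` (V `\` F i)))).
    by apply: le_outer_measure => x Vx; have [h|h] := pselect (F i x); [left|right].
  apply: (le_trans (outer_measureU2 mu _ _)); apply: leeD2l; apply: IH => x [Vx nF].
  by have [j] := Vr _ Vx; rewrite in_cons => /predU1P[->//|js] Fj; exists j.
have h : mu U <= mu (F a) + (mu (F b `&` ~` F a) + \sum_(j <- s') mu (F j)).
  apply: (@le_trans _ _ (mu (F a `|` ((F b `&` ~` F a) `|` (U `\` (F a `|` F b)))))).
    apply: le_outer_measure => x Ux; have [fa|fa] := pselect (F a x); first by left.
    by right; have [fb|fb] := pselect (F b x); [left|right; split => // -[]].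
  apply: (le_trans (outer_measureU2 mu _ _)); apply: leeD2l.
  apply: (le_trans (outer_measureU2 mu _ _)); apply: leeD2l; apply: U_le => x [Ux nF].
  have [j] := Us _ Ux; rewrite (perm_mem sab) !in_cons => /or3P[/eqP->|/eqP->|js] Fj.
  - by exfalso; apply: nF; left.
  - by exfalso; apply: nF; right.
  - by exists j.
have fin A : A <= mu U -> 0 <= A -> A \is a fin_num.
  by move=> AU A0; rewrite ge0_fin_numE // (le_lt_trans AU).
have fa : mu (F a) \is a fin_num.
  by apply: fin => //; apply: le_trans sU; rewrite leeDl // adde_ge0.
have fb : mu (F b) \is a fin_num.
  by apply: fin => //; apply: le_trans sU; rewrite addeCA leeDl // adde_ge0.
have fs : \sum_(j <- s') mu (F j) \is a fin_num.
  by apply: fin => //; apply: le_trans sU; rewrite addeA leeDr // adde_ge0.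
have fI : mu (F b `&` F a) \is a fin_num.
  rewrite ge0_fin_numE //; apply: le_lt_trans (_ : _ <= mu (F b)) _; last by rewrite -ge0_fin_numE.
  by apply: le_outer_measure => x [].
have fD : mu (F b `&` ~` F a) \is a fin_num.
  rewrite ge0_fin_numE //; apply: le_lt_trans (_ : _ <= mu (F b)) _; last by rewrite -ge0_fin_numE.
  by apply: le_outer_measure => x [].
move: (le_trans sU h); rewrite leeD2lE // leeD2rE // (cF a (F b)).
rewrite -leeBrDr // subee // => hI; rewrite setIC.
by apply/eqP; rewrite eq_le hI mu0.
Qed.

End OuterMeasureLists.

(** * Measurability of closed sets *)

Section ClosedSetsMeasurable.
Context {R : realType} {d : nat}.
Let K := d.+1.
Let V := 'cV[R]_K.

(** A hyperplane of a coordinate direction cuts each box of a cover into two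
   boxes, the volumes of which add up. *)
Lemma caratheodory_half_space (i : 'I_K) (c : R) :
  (@lebesgue_d R K).-caratheodory [set x : V | x i 0 <= c].
Proof.
apply: le_caratheodory_measurable => X.
have [Xoo|Xoo] := leP +oo%E (lebesgue_d X); first by apply: le_trans Xoo; rewrite leey.
apply/lee_addgt0Pr => e e0.
have [[a b] /= [[ab cov] sume]] := lebesgue_d_cover_approx Xoo e0.
apply: le_trans sume.
(* The height of the cut, moved to the nearest face if the hyperplane misses the
   box. *)
pose m k := Num.max (a k i 0) (Num.min (b k i 0) c).
pose b' k : V := \col_j if j == i then m k else b k j 0.
pose a' k : V := \col_j if j == i then m k else a k j 0.
have am k : a k i 0 <= m k <= b k i 0.
  by rewrite /m le_max lexx /= ge_max ab ge_min lexx.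
have volE k : box_volume (a k) (b k) = box_volume (a k) (b' k) + box_volume (a' k) (b k).
  have vE (u v : V) : (forall j, j != i -> v j 0 - u j 0 = b k j 0 - a k j 0) ->
      box_volume u v = (v i 0 - u i 0) * \prod_(j < K | j != i) (b k j 0 - a k j 0).
    by move=> uv; rewrite /box_volume (bigD1 i) //=; congr (_ * _); exact: eq_bigr.
  rewrite !vE => [|j /negbTE ji|j /negbTE ji|//]; first last.
  - by rewrite mxE ji.
  - by rewrite mxE ji.
  by rewrite -mulrDl !mxE eqxx; congr (_ * _); ring.
have c1 : box_cover (X `&` [set x : V | x i 0 <= c]) a b'.
  split=> [k j|x [/cov[k _ xk] /= xc]].
    by rewrite mxE; case: eqP => [->|//]; have /andP[] := am k.
  exists k => // j; rewrite mxE; have /andP[x1 x2] := xk j; rewrite x1 /=.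
  by case: eqP x2 => [->|//] x2; rewrite le_max le_min x2 xc orbT.
have c2 : box_cover (X `&` ~` [set x : V | x i 0 <= c]) a' b.
  split=> [k j|x [/cov[k _ xk] /= /negP]].
    by rewrite mxE; case: eqP => [->|//]; have /andP[] := am k.
  rewrite -ltNge => xc; exists k => // j; rewrite mxE; have /andP[x1 x2] := xk j; rewrite x2 andbT.
  by case: eqP x1 => [->|//] x1; rewrite gt_max x1 gt_min xc orbT.
apply: (le_trans (leeD (lebesgue_d_le_boxes c1) (lebesgue_d_le_boxes c2))).
rewrite -nneseriesD; first last.
- by move=> k _ _; rewrite lee_fin box_volume_ge0 //; exact: c2.1.
- by move=> k _ _; rewrite lee_fin box_volume_ge0 //; exact: c1.1.
by rewrite (eq_eseriesr (g := fun k => (box_volume (a k) (b k))%:E)) // => k _; rewrite volE EFinD.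
Qed.

Lemma caratheodory_box (a b : V) : (@lebesgue_d R K).-caratheodory (box a b).
Proof.
have H (s : seq 'I_K) : (@lebesgue_d R K).-caratheodory
    [set x : V | forall i, i \in s -> a i 0 < x i 0 <= b i 0].
  elim: s => [|i s IH].
    rewrite (_ : mkset _ = ~` set0); last by rewrite setC0; apply/seteqP; split.
    exact/caratheodory_measurable_setC/caratheodory_measurable_set0.
  rewrite (_ : mkset _ = ([set x : V | x i 0 <= b i 0] `\` [set x : V | x i 0 <= a i 0]) `&`
      [set x : V | forall j, j \in s -> a j 0 < x j 0 <= b j 0]).
    apply: caratheodory_measurable_setI IH.
    by apply: caratheodory_measurable_setD; exact: caratheodory_half_space.
  apply/seteqP; split => [x /= H|x [[/= h1 /negP h2] h3] j].
    split; last by move=> j js; apply: H; rewrite in_cons js orbT.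
    have /andP[h1 h2] : a i 0 < x i 0 <= b i 0 by apply: H; rewrite mem_head.
    by split => //; apply/negP; rewrite -ltNge.
  by rewrite in_cons => /predU1P[->|/h3//]; rewrite h1 andbT ltNge.
rewrite (_ : box a b = [set x : V | forall i, i \in enum 'I_K -> a i 0 < x i 0 <= b i 0]) //.
by apply/seteqP; split => [x xab i _|x xab i]; [exact: xab|apply: xab; rewrite mem_enum].
Qed.

(** An open set is the union of the countably many boxes with rational corners
   that it contains. *)
Lemma caratheodory_open (U : set V) : open U -> (@lebesgue_d R K).-caratheodory U.
Proof.
move=> oU.
pose toV (p : 'cV[rat]_K) : V := map_mx ratr p.
pose F (k : nat) : set V :=
  if (choice.unpickle k : option ('cV[rat]_K * 'cV[rat]_K)) is Some (p, q) then
  [set x | box (toV p) (toV q) `<=` U /\ box (toV p) (toV q) x] else set0.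
have -> : U = \bigcup_k F k.
  apply/seteqP; split => [x Ux|x [k _]]; last first.
    by rewrite /F; case: (choice.unpickle k) => // -[p q] [h1 h2]; exact: h1.
  have [e /= e0 eU] := (nbhs_ballP _ _).1 (open_nbhs_nbhs (conj oU Ux)).
  have H i : exists pq : rat * rat, x i 0 - e < ratr pq.1 < x i 0 /\ x i 0 < ratr pq.2 < x i 0 + e.
    have [p ph] := @rat_in_itvoo R (x i 0 - e) (x i 0) ltac:(by rewrite ltrBlDr ltrDl).
    have [q qh] := @rat_in_itvoo R (x i 0) (x i 0 + e) ltac:(by rewrite ltrDl).
    by exists (p, q); move: ph qh; rewrite !in_itv.
  have [pq pqh] := choice H.
  pose p : 'cV[rat]_K := \col_i (pq i).1; pose q : 'cV[rat]_K := \col_i (pq i).2.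
  exists (choice.pickle (p, q)) => //; rewrite /F choice.pickleK; split; last first.
    by move=> i; rewrite !mxE; have [/andP[_ ->] /andP[/ltW -> _]] := pqh i.
  move=> y yb; apply: eU; split=> // i j; rewrite ord1 /ball /= ltr_distlC.
  have := yb i; rewrite !mxE => /andP[y1 y2].
  have [/andP[h1 h2] /andP[h3 h4]] := pqh i.
  by rewrite (lt_trans h1 y1) (le_lt_trans y2 h4).
apply: caratheodory_measurable_bigcup => k; rewrite /F.
case: (choice.unpickle k) => [[p q]|]; last exact: caratheodory_measurable_set0.
have [h|h] := pselect (box (toV p) (toV q) `<=` U).
  rewrite (_ : mkset _ = box (toV p) (toV q)); first exact: caratheodory_box.
  by apply/seteqP; split => [x []|x].
rewrite (_ : mkset _ = set0); first exact: caratheodory_measurable_set0.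
by apply/seteqP; split => [x []|x].
Qed.

Lemma caratheodory_closed (C : set V) : closed C -> (@lebesgue_d R K).-caratheodory C.
Proof.
move=> cC; rewrite -[C]setCK; apply: caratheodory_measurable_setC.
exact/caratheodory_open/closed_openC.
Qed.

Lemma lebesgue_d_bounded (E : set V) (r : R) : (forall x, E x -> `|x| <= r) ->
  (lebesgue_d E < +oo)%E.
Proof.
move=> Er; have [[x Ex]|E0] := pselect (exists x, E x); last first.
  rewrite (_ : E = set0) ?lebesgue_d0 // -subset0 => x Ex; apply: E0; by exists x.
have r0 : 0 <= r by apply: le_trans (Er x Ex).
apply: (@le_lt_trans _ _ (lebesgue_d (box (const_mx (- r - 1)) (const_mx r) : set V))).
  apply: le_lebesgue_d => y /Er yr i; rewrite !mxE.
  have := le_trans (entry_le_norm y i) yr; rewrite ler_norml => /andP[h1 ->].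
  by rewrite andbT (lt_le_trans _ h1) // ltrBlDr ltrDl.
apply: le_lt_trans (lebesgue_d_box _ _) (ltry _) => // i; rewrite !mxE; lra.
Qed.

End ClosedSetsMeasurable.

(** * Topology of column vectors *)

Lemma continuous_of_lipschitz (R : realType) (U W : normedModType R) (f : U -> W) (C : R) :
  (forall x y, `|f x - f y| <= C * `|x - y|) -> continuous f.
Proof.
move=> fC x; apply/cvgrPdist_le => e e0.
have C1 : 0 < `|C| + 1 by rewrite ltr_wpDl.
near=> y; apply: (le_trans (fC x y)).
apply: (@le_trans _ _ ((`|C| + 1) * `|x - y|)).
  by apply: ler_wpM2r => //; rewrite (le_trans (ler_norm C)) // lerDl.
rewrite -ler_pdivlMl // mulrC; near: y.
by apply: cvgr_dist_le; [exact: cvg_id|rewrite divr_gt0].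
Unshelve. all: by end_near.
Qed.

Lemma affine_map_continuous (R : realType) (d : nat) (M : 'M[R]_d) (e : 'cV[R]_d) :
  continuous (fun x : 'cV[R]_d => M *m x - e).
Proof.
have [C [_ HC]] := mulmx_bounded M.
apply: (@continuous_of_lipschitz _ _ _ _ C) => x y.
by rewrite opprB addrA subrK -mulmxBr.
Qed.

Lemma translateP (R : realType) (d : nat) (U : set 'cV[R]_d) (x y : 'cV[R]_d) :
  translate U x y <-> U (y - x).
Proof.
split=> [[t Ut <-]|Uy]; first by rewrite addrK.
by exists (y - x) => //; rewrite subrK.
Qed.

Lemma closed_translate (R : realType) (d : nat) (U : set 'cV[R]_d) (x : 'cV[R]_d) :
  closed U -> closed (translate U x).
Proof.
move=> cU; rewrite (_ : translate U x = (fun y => 1%:M *m y - x) @^-1` U).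
  apply: closed_comp; last exact: cU.
  by move=> y _; exact: affine_map_continuous.
by apply/seteqP; split=> y; rewrite /= mul1mx => /translateP.
Qed.

Lemma interior_norm_ball (R : realType) (d : nat) (U : set 'cV[R]_d) v : U° v ->
  exists2 e : R, 0 < e & forall x, `|x - v| <= e -> U x.
Proof.
move=> /nbhs_ballP[e /= e0 eU]; exists (e / 2); first by rewrite divr_gt0.
move=> x xv; apply: eU; rewrite -ball_normE /ball_ /= distrC (le_lt_trans xv) //.
by rewrite ltr_pdivrMr // mulr_natr mulr2n ltrDl.
Qed.

(** The transposition is an isometry onto the row vectors, where closed bounded
   sets are known to be compact. *)
Lemma compact_col_bounded (R : realType) (d : nat) (A : set 'cV[R]_d) (r : R) :
  closed A -> (forall x, A x -> `|x| <= r) -> compact A.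
Proof.
move=> cA Ar.
have tr_le m n (x : 'M[R]_(m, n)) : `|x^T| <= `|x|.
  rewrite [leLHS]/Num.norm [leRHS]/Num.norm /= !mx_normrE.
  apply: bigmax_le; first by apply: bigmax_ge_id.
  by move=> [i j] _ /=; rewrite mxE; apply: (le_bigmax _ (fun ij : 'I_m * 'I_n => `|x ij.1 ij.2|) (j, i)).
have tr_cont m n : continuous (fun x : 'M[R]_(m, n) => x^T).
  by apply: (@continuous_of_lipschitz _ _ _ _ 1) => x y; rewrite mul1r -linearB; exact: tr_le.
pose A' : set 'rV[R]_d := (fun v : 'rV[R]_d => v^T) @^-1` A.
have -> : A = [set v^T | v in A'].
  by apply/seteqP; split=> [x Ax|_ [v Av <-]//]; exists x^T; rewrite /A' /= ?trmxK.
apply: continuous_compact.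
  by apply: continuous_subspaceT => v; exact: tr_cont.
apply: bounded_closed_compact.
  exists r; split; first exact: num_real.
  move=> s rs v /= Av; rewrite -[v]trmxK (le_trans (tr_le _ _ _)) //.
  by rewrite (le_trans (Ar _ Av)) // ltW.
by apply: closed_comp cA => v _; exact: tr_cont.
Qed.

Lemma compact_col_norm_le (R : realType) (d : nat) (E : set 'cV[R]_d) : compact E ->
  exists2 r : R, 0 < r & forall x, E x -> `|x| <= r.
Proof.
move=> /compact_bounded[M [_ HM]]; exists (`|M| + 1) => [|x Ex]; first by rewrite ltr_wpDl.
by apply: HM Ex; rewrite (le_lt_trans (ler_norm M)) // ltrDl.
Qed.

(** * Sets with interior points have positive measure *)

Section CubePositive.
Context {R : realType} {d : nat}.
Let K := d.+1.
Let V := 'cV[R]_K.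

Lemma card_nat_open_interval (N : nat) (a b : R) : a <= b ->
  \sum_(j < N) (a < j%:R < b)%R%:R <= b - a + 1 :> R.
Proof.
move=> ab; rewrite -natr_sum.
have [[j0 j0P]|H] := pselect (exists j : 'I_N, a < j%:R < b); last first.
  rewrite big1 => [|j _]; first by apply: addr_ge0 => //; rewrite subr_ge0.
  by case: (boolP (a < j%:R < b)) => // jP; exfalso; apply: H; exists j.
pose P (j : 'I_N) := a < j%:R < b.
case: (@arg_minnP _ j0 P val j0P) => m mP mmin.
set t := Num.truncn (b - a).
have tP : t%:R <= b - a < t.+1%:R by apply: truncn_itv; rewrite subr_ge0.
apply: (@le_trans _ _ t.+1%:R); last by rewrite -natr1 lerD2r; case/andP: tP.
have -> : (\sum_(j < N) (a < j%:R < b)%R = #|[pred j | P j]|)%N.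
  by rewrite -sum1_card [RHS]big_mkcond /=; apply: eq_bigr => j _; rewrite inE -/(P j); case: (P j).
rewrite ler_nat -[leqRHS]card_ord.
pose f (j : 'I_N) : 'I_t.+1 := inord (j - m).
apply: (@leq_card_in _ _ f) => j k; rewrite !inE => jP kP.
have lt j' : P j' -> (j' - m < t.+1)%N.
  move=> /[dup] /mmin mj /andP[_ j1]; rewrite -(ltr_nat R).
  case/andP: tP => _; apply: le_lt_trans; rewrite natrB //.
  by have /andP[m1 _] := mP; lra.
move=> /(congr1 val) /=; rewrite !inordK ?lt // => e; apply/val_inj.
by move: (mmin _ jP) (mmin _ kP) e => /=; lia.
Qed.

(** Grid points are counted: a finite cover of the unit cube by open boxes
   contains all [N ^ d] points of a grid of mesh [1 / N], and a box of sides
   [l i] contains at most [N ^ d] times the product of the [l i + 1 / N]. *)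
Lemma lebesgue_d_unit_cube : (0 < lebesgue_d (@unit_cube R d))%E.
Proof.
rewrite ltNge; apply/negP => Q0.
have Qoo : (lebesgue_d (@unit_cube R d) < +oo)%E by rewrite (le_lt_trans Q0).
have [[a b] /= [[ab cov] sume]] := lebesgue_d_cover_approx Qoo (@divr_gt0 R 1 2 ltr01 (ltr0Sn _ _)).
(* Each box is enlarged twice by [e k]: once to make it open, and once to leave
   room for the mesh of the grid. *)
pose eta k : R := 4^-1 / (2 ^ k.+1)%:R.
have eta0 k : 0 < eta k by rewrite divr_gt0.
have [e ee] : {e : nat -> R & forall k, 0 < e k /\
    \prod_i (b k i 0 - a k i 0 + 2 * e k) < box_volume (a k) (b k) + eta k}.
  apply: (@choice _ _ (fun k (ek : R) => 0 < ek /\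
    \prod_i (b k i 0 - a k i 0 + 2 * ek) < box_volume (a k) (b k) + eta k)) => k.
  have lt : \prod_i (b k i 0 - a k i 0) < box_volume (a k) (b k) + eta k by rewrite ltrDl.
  have H := prod_affine_near_lt 2 lt.
  near (0 : R)^'+ => e; exists e; split; first by near: e; exact: nbhs_right_gt.
  by near: e.
pose O k : set V := [set x | forall i, a k i 0 < x i 0 < b k i 0 + e k].
have oO k : open (O k).
  rewrite openE => x xO; apply/nbhs_ballP.
  have : \forall s \near (0 : R)^'+, forall i, s < x i 0 - a k i 0 /\ s < b k i 0 + e k - x i 0.
    apply: filter_forall => i; have /andP[h1 h2] := xO i.
    by near=> s; split; near: s; apply: nbhs_right_lt; rewrite subr_gt0.
  move=> H; near (0 : R)^'+ => s.
  have s0 : 0 < s by near: s; exact: nbhs_right_gt.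
  have H' : forall i, s < x i 0 - a k i 0 /\ s < b k i 0 + e k - x i 0 by near: s.
  exists s => // y [_ xy] i; have := xy i 0; rewrite /ball /= ltr_distlC => /andP[h1 h2].
  by have [h3 h4] := H' i; apply/andP; split; lra.
have cQ : compact (@unit_cube R d).
  apply: (@compact_col_bounded _ _ _ 1) => [|x xQ]; last first.
    by apply/ler_col_norm => // i; have /andP[h1 h2] := xQ i; rewrite ger0_norm.
  have -> : @unit_cube R d = \bigcap_(i in [set: 'I_K]) ((fun x : V => x i 0) @^-1` `[0, 1]%classic).
    apply/seteqP; split=> x H i; first by move=> _; rewrite /= in_itv /=; exact: H.
    by have := H i I; rewrite /= in_itv.
  apply: closed_bigI => i _; apply: closed_comp; last exact: interval_closed.
  move=> x _; apply: (@continuous_of_lipschitz _ _ _ (fun x : V => x i 0) 1) => {}x y.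
  by rewrite mul1r; have := entry_le_norm (x - y) i; rewrite !mxE.
have [n Hn] : exists n, forall x, unit_cube x -> exists k : 'I_n, O k x.
  have := cQ; rewrite compact_cover => /(_ nat setT O (fun k _ => oO k)).
  case=> [x /cov[k _ xk]|D _ HD].
    exists k => // i; have /andP[-> /= h] := xk i.
    by rewrite (le_lt_trans h) // ltrDl; exact: (ee k).1.
  exists (\max_(k : D) (val k)).+1 => x /HD[k /= kD xk].
  have kn : (k < (\max_(k : D) (val k)).+1)%N by rewrite ltnS (leq_bigmax [` kD]%fset).
  by exists (Ordinal kn).
have [N N0 NP] : exists2 N, (0 < N)%N & forall k : 'I_n, N%:R^-1 <= e k.
  have : \forall N \near \oo, forall k : 'I_n, (N.+1%:R^-1 : R) <= e k.
    apply: filter_forall => k.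
    have := near_infty_natSinv_lt (PosNum (ee k).1); apply: filterS => N /=.
    exact: ltW.
  by case=> N _ HN; exists N.+1 => // k; exact: (HN N (leqnn N)).
have N0' : 0 < N%:R :> R by rewrite ltr0n.
have main : 1 <= \sum_(k < n) \prod_i (b k i 0 - a k i 0 + 2 * e k).
  rewrite -(ler_pM2r (exprn_gt0 K N0')) mul1r mulr_suml.
  apply: (@le_trans _ _ (\sum_(f : {ffun 'I_K -> 'I_N}) \sum_(k < n)
     \prod_i (N%:R * a k i 0 < (f i)%:R < N%:R * (b k i 0 + e k))%R%:R)).
    apply: (@le_trans _ _ (\sum_(f : {ffun 'I_K -> 'I_N}) 1)).
      by rewrite sumr_const card_ffun !card_ord natrX.
    apply: ler_sum => f _; pose x : V := \col_i ((f i)%:R / N%:R).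
    have [k xk] : exists k : 'I_n, O k x.
      apply: Hn => i; rewrite mxE divr_ge0 ?ler0n //= ler_pdivrMr // mul1r ler_nat.
      exact: ltnW.
    rewrite (bigD1 k) //= big1 => [|i _]; last first.
      have := xk i; rewrite mxE ltr_pdivlMr // ltr_pdivrMr //.
      by rewrite (mulrC (a _ _ _)) (mulrC (_ + _)) => ->.
    by rewrite lerDl; apply: sumr_ge0 => j _; apply: prodr_ge0.
  rewrite exchange_big /=; apply: ler_sum => k _.
  rewrite -(bigA_distr_bigA (fun (i : 'I_K) (j : 'I_N) =>
    (N%:R * a k i 0 < j%:R < N%:R * (b k i 0 + e k))%R%:R : R)).
  have -> : N%:R ^+ K = \prod_(i < K) (N%:R : R) by rewrite prodr_const card_ord.
  rewrite -big_split /=; apply: ler_prod => i _; rewrite sumr_ge0 //=.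
  have ek0 := (ee k).1; have abi := ab k i.
  apply: (le_trans (card_nat_open_interval _ _)); first by rewrite ler_pM2l //; lra.
  have h : 1 <= e k * N%:R by rewrite -ler_pdivrMr // mul1r.
  rewrite -mulrBr mulrC [leRHS]mulrDl -lerBrDl; nra.
have vol_le : \sum_(k < n) box_volume (a k) (b k) <= 1 / 2.
  rewrite -lee_fin -sumEFin -(big_mkord xpredT (fun k => (box_volume (a k) (b k))%:E)).
  apply: le_trans (_ : (_ <= \sum_(0 <= k <oo) (box_volume (a k) (b k))%:E)%E) _.
    by apply: nneseries_lim_ge => k _ _; rewrite lee_fin box_volume_ge0.
  apply: (le_trans sume); rewrite -[leRHS]add0e; exact: leeD2r.
have eta_le : \sum_(k < n) eta k <= 4^-1.
  rewrite -lee_fin -sumEFin -(big_mkord xpredT (fun k => (eta k)%:E)).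
  apply: le_trans (_ : (_ <= \sum_(0 <= k <oo) (eta k)%:E)%E) _.
    by apply: nneseries_lim_ge => k _ _; rewrite lee_fin ltW.
  by apply: epsilon_trick0.
have : (1 : R) <= 1 / 2 + 4^-1.
  apply: (le_trans main); apply: (le_trans _ (lerD vol_le eta_le)).
  by rewrite -big_split; apply: ler_sum => k _; rewrite ltW //; exact: (ee k).2.
lra.
Unshelve. all: by end_near.
Qed.

Lemma lebesgue_d_ball_gt0 (E : set V) (p : V) (r : R) : 0 < r ->
  (forall x, `|x - p| <= r -> E x) -> (0 < lebesgue_d E)%E.
Proof.
move=> r0 pE.
have ur : (r%:M : 'M[R]_K) \in unitmx by rewrite unitmxE det_scalar unitrX // unitfE lt0r_neq0.
have := lebesgue_d_unit_cube.
apply: contraTT; rewrite -!leNgt => E0.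
have : (lebesgue_d [set (r%:M : 'M[R]_K) *m x | x in @unit_cube R d] <= 0)%E.
  apply: le_trans E0; rewrite -(lebesgue_d_translate p) //; apply: le_lebesgue_d.
  move=> _ [_ [x xu <-] <-]; apply: pE; rewrite addrK mul_scalar_mx normrZ gtr0_norm //.
  rewrite -[leRHS]mulr1 ler_pM2l //; apply/ler_col_norm => // i.
  by have /andP[h1 h2] := xu i; rewrite ger0_norm.
by rewrite lebesgue_d_linear // pmule_rle0 // lte_fin normr_gt0 -unitfE -unitmxE.
Qed.
End CubePositive.

(** * Digits of the iterated inflation *)

Section Digits.
Context {R : realType} {d n : nat}.
Variables (A : 'M[R]_d) (D : 'I_n -> 'I_n -> {fset 'cV[R]_d}).
Hypothesis hA : expanding A.
Let V := 'cV[R]_d.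
Let Ai := invmx A.

(** [digits k i j] lists, with repetitions, the digit multiset of the [k]-th
   iterate of the inflation. *)
Fixpoint digits (k : nat) (i j : 'I_n) : seq V :=
  if k is k'.+1 then
    flatten [seq [seq e + A ^+ k' *m c | e <- digits k' i l, c <- (D l j : seq V)] | l <- enum 'I_n]
  else if i == j then [:: 0] else [::].

Lemma expr_mulmxK k : cancel (mulmx (A ^+ k) : V -> V) (mulmx (Ai ^+ k)).
Proof.
have uA := expanding_unitmx hA.
elim: k => [|k IH] x; first by rewrite !expr0 !mul1mx.
by rewrite exprSr exprS -[A * _]/(A *m _) -[_ * Ai]/(_ *m Ai) -!mulmxA (mulmxA Ai) mulVmx // mul1mx IH.
Qed.

Lemma expr_mulmxVK k : cancel (mulmx (Ai ^+ k) : V -> V) (mulmx (A ^+ k)).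
Proof.
have uA := expanding_unitmx hA.
elim: k => [|k IH] x; first by rewrite !expr0 !mul1mx.
by rewrite exprSr exprS -[_ * A]/(_ *m A) -[Ai * _]/(Ai *m _) -!mulmxA (mulmxA A) mulmxV // mul1mx IH.
Qed.

Lemma digits0 i j : digits 0 i j = if i == j then [:: 0] else [::].
Proof. by []. Qed.

Lemma big_digitsS (M : nmodType) (k : nat) (i j : 'I_n) (G : V -> M) :
  \sum_(e <- digits k.+1 i j) G e =
  \sum_l \sum_(e <- digits k i l) \sum_(c <- (D l j : seq V)) G (e + A ^+ k *m c).
Proof.
rewrite /= big_flatten big_map big_enum /=; apply: eq_bigr => l _.
by rewrite big_allpairs_dep.
Qed.

Lemma mem_digitsS k i j e : e \in digits k.+1 i j <->
  exists l e1 c, [/\ e1 \in digits k i l, c \in D l j & e = e1 + A ^+ k *m c].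
Proof.
split=> [/flatten_mapP[l _ /allpairsP[[e1 c] /= [h1 h2 ->]]]|[l [e1 [c [h1 h2 ->]]]]].
  by exists l, e1, c.
apply/flatten_mapP; exists l; first by rewrite mem_enum.
by apply/allpairsP; exists (e1, c).
Qed.

Lemma mem_digitsD k m i j e : e \in digits (k + m) i j <->
  exists l e1 e2, [/\ e1 \in digits k i l, e2 \in digits m l j & e = e1 + A ^+ k *m e2].
Proof.
elim: m j e => [|m IH] j e.
  rewrite addn0; split=> [h|[l [e1 [e2 []]]]].
    by exists j, e, 0; rewrite /= eqxx mem_head mulmx0 addr0.
  by rewrite /=; case: eqP => // ->; rewrite inE => h /eqP -> ->; rewrite mulmx0 addr0.
rewrite addnS; split.
  move=> /mem_digitsS[l [e1 [c [/IH[l' [f1 [f2 [h1 h2 ->]]]] h3 ->]]]].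
  exists l', f1, (f2 + A ^+ m *m c); split=> //; last by rewrite mulmxDr addrA exprD -mulmxA.
  by apply/mem_digitsS; exists l, f2, c.
move=> [l [e1 [e2 [h1 /mem_digitsS[l' [f2 [c [h2 h3 ->]]]] ->]]]].
apply/mem_digitsS; exists l', (e1 + A ^+ k *m f2), c; split => //.
  by apply/IH; exists l, e1, f2.
by rewrite mulmxDr addrA exprD -mulmxA.
Qed.

Lemma mem_digits1 i j e : e \in digits 1 i j <-> e \in D i j.
Proof.
split; first move=> /mem_digitsS[l [e1 [c []]]].
  rewrite /=; case: eqP => // ->; rewrite inE => /eqP -> h ->.
  by rewrite add0r mul1mx.
move=> h; apply/mem_digitsS; exists i, 0, e; split => //; first by rewrite /= eqxx mem_head.
by rewrite add0r mul1mx.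
Qed.

Lemma size_digits k i j : (size (digits k i j))%:R = (subdivision_matrix D ^+ k) i j :> R.
Proof.
elim: k j => [|k IH] j.
  by rewrite /= expr0 mxE; case: (i == j).
rewrite exprSr -[RHS]/((_ *m _) i j) mxE.
have -> : (size (digits k.+1 i j))%:R = \sum_(e <- digits k.+1 i j) (1 : R).
  by rewrite -sum1_size natr_sum.
rewrite big_digitsS; apply: eq_bigr => l _; rewrite -IH mxE.
rewrite (eq_bigr (fun=> (#|` D l j|)%:R)) => [|e _].
  by rewrite big_const_seq count_predT iter_addr_0 mulr_natl.
by rewrite big_const_seq count_predT iter_addr_0.
Qed.

Lemma sum_digits_const k i j (w : R) :
  \sum_(e <- digits k i j) w = w * (subdivision_matrix D ^+ k) i j.
Proof. by rewrite -size_digits -sum1_size natr_sum mulr_sumr; apply: eq_bigr => e _; rewrite mulr1. Qed.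

Lemma digits_nonempty k i j : 0 < (subdivision_matrix D ^+ k) i j ->
  exists e, e \in digits k i j.
Proof.
rewrite -size_digits ltr0n; case: (digits k i j) => // e s _.
by exists e; rewrite mem_head.
Qed.

Lemma iter_inflation k (X : 'I_n -> multiset R d) i x :
  iter k (inflation A D) X i x =
  (\sum_j \sum_(e <- digits k i j) X j (Ai ^+ k *m (x - e)))%N.
Proof.
elim: k X i x => [|k IH] X i x.
  rewrite /= (bigD1 i) //= eqxx big_seq1 subr0 expr0 mul1mx.
  by rewrite big1 ?addn0 // => j /negbTE ji; rewrite eq_sym ji big_nil.
rewrite iterSr IH /inflation.
under [RHS]eq_bigr => j _ do rewrite (big_digitsS (M := nat)).
rewrite [RHS]exchange_big /=; apply: eq_bigr => l _.
rewrite [RHS]exchange_big /=; apply: eq_bigr => e _.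
apply: eq_bigr => j _; apply: eq_bigr => c _.
rewrite /mimage; congr (X j _); rewrite exprS -[Ai * _]/(Ai *m _) -mulmxA; congr (_ *m _).
by rewrite opprD addrA [RHS]mulmxBr expr_mulmxK.
Qed.

Lemma mem_big_sumset (N : nat) (G : nat -> seq V) (x : V) :
  x \in \big[(fun s t => [seq y + z | y <- s, z <- t])/[:: 0]]_(k < N) G k <->
  exists f : nat -> V, (forall k, (k < N)%N -> f k \in G k) /\ x = \sum_(k < N) f k.
Proof.
elim: N G x => [|N IH] G x.
  rewrite big_ord0 inE; split=> [/eqP ->|[f [_ ->]]]; last by rewrite big_ord0.
  by exists (fun=> 0); rewrite big_ord0.
rewrite big_ord_recl; split.
  move=> /allpairsP[[y z] /= [yG /(IH (fun k => G k.+1))[f [fG ->]] ->]].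
  exists (fun k => if k is k'.+1 then f k' else y); split; last by rewrite big_ord_recl.
  by case=> // k; exact: fG.
move=> [f [fG ->]]; rewrite big_ord_recl; apply/allpairsP.
exists (f 0%N, \sum_(k < N) f k.+1); split => //=; first exact: fG.
by apply/(IH (fun k => G k.+1)); exists (fun k => f k.+1); split => // k kN; exact: fG.
Qed.

Lemma digits_path N i j e : e \in digits N i j <->
  exists (p : nat -> 'I_n) (f : nat -> V), [/\ p 0%N = i, p N = j,
    forall k, (k < N)%N -> f k \in D (p k) (p k.+1) & e = \sum_(k < N) A ^+ k *m f k].
Proof.
elim: N j e => [|N IH] j e.
  rewrite /=; case: eqP => [->|ij]; split => //.
  - by rewrite inE => /eqP ->; exists (fun=> j), (fun=> 0); split; rewrite ?big_ord0.
  - by move=> [p [f [_ _ _ ->]]]; rewrite big_ord0 mem_head.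
  - by move=> [p [f [pi pj _ _]]]; case: ij; rewrite -pi -pj.
split.
  move=> /mem_digitsS[l [e1 [c [/IH[p [f [p0 pN fD ->]]] cD ->]]]].
  exists (fun k => if (k <= N)%N then p k else j), (fun k => if (k < N)%N then f k else c).
  split => //; first by rewrite ltnn.
    move=> k; rewrite ltnS => kN; rewrite kN; case: ltnP => [kN'|Nk]; first exact: fD.
    have -> : k = N by apply/eqP; rewrite eqn_leq kN Nk.
    by rewrite pN.
  rewrite big_ord_recr /= ltnn; congr (_ + _).
  by apply: eq_bigr => k _; rewrite ltn_ord.
move=> [p [f [p0 pN fD ->]]]; apply/mem_digitsS.
exists (p N), (\sum_(k < N) A ^+ k *m f k), (f N); split.
- by apply/IH; exists p, f; split => // k kN; apply: fD; rewrite ltnW.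
- by rewrite -pN; exact: fD.
- by rewrite big_ord_recr.
Qed.

Lemma mem_iterated_digits N i j e :
  e \in iterated_digits A D N i j <-> e \in digits N i j.
Proof.
have mem_bigcat (I : finType) (P : pred I) (F : I -> seq V) x :
    x \in \big[cat/[::]]_(p | P p) F p <-> exists2 p, P p & x \in F p.
  rewrite -big_filter; set s := seq.filter _ _.
  have sP p : p \in s = P p by rewrite mem_filter mem_index_enum andbT.
  have -> : (exists2 p, P p & x \in F p) <-> (exists2 p, p \in s & x \in F p).
    by split=> -[p h1 h2]; exists p => //; [rewrite sP|rewrite -sP].
  elim: (s) => [|p r IH]; first by rewrite big_nil; split => // -[p]; rewrite in_nil.
  rewrite big_cons mem_cat; split.
    case/orP=> [h|/IH[q qr h]]; first by exists p; rewrite ?mem_head.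
    by exists q; rewrite // in_cons qr orbT.
  move=> [q]; rewrite in_cons => /predU1P[->|qr] h; first by rewrite h.
  by apply/orP; right; apply/IH; exists q.
have sumset (p : 'I_N.+1 -> 'I_n) := mem_big_sumset N
  (fun k => [seq A ^+ k *m c | c <- (D (p (inord k)) (p (inord k.+1)) : seq V)]) e.
rewrite digits_path /iterated_digits; split.
  move=> /mem_bigcat[p /andP[/eqP p0 /eqP pN] /sumset[f [fG ->]]].
  have [g gP] : {g : nat -> V & forall k, (k < N)%N ->
      g k \in D (p (inord k)) (p (inord k.+1)) /\ f k = A ^+ k *m g k}.
    apply: (@choice _ _ (fun k g => (k < N)%N ->
      g \in D (p (inord k)) (p (inord k.+1)) /\ f k = A ^+ k *m g)) => k.
    have [kN|kN] := ltnP k N; last by exists 0.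
    by have /mapP[c cD fE] := fG _ kN; exists c.
  exists (fun k => p (inord k)), g; split.
  - by rewrite -p0; congr (p _); apply/val_inj; rewrite /= inordK.
  - by rewrite -pN; congr (p _); apply/val_inj; rewrite /= inordK.
  - by move=> k /gP[].
  - by apply: eq_bigr => k _; have [] := gP k (ltn_ord k).
move=> [p [f [p0 pN fD eE]]]; apply/mem_bigcat.
exists [ffun k : 'I_N.+1 => p k]; first by rewrite !ffunE p0 pN !eqxx.
apply/sumset; exists (fun k => A ^+ k *m f k); split => // k kN.
rewrite !ffunE !inordK ?ltnS // ?(ltnW kN) //.
by apply/mapP; exists (f k) => //; exact: fD.
Qed.

End Digits.

(** * Compact solutions of the multi-tile equations *)

Section MultiTiles.
Context {R : realType} {d n : nat}.
Variables (A : 'M[R]_d) (D : 'I_n -> 'I_n -> {fset 'cV[R]_d}).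
Hypotheses (hA : expanding A) (hS : primitive (subdivision_matrix D)).
Let V := 'cV[R]_d.
Let Ai := invmx A.
Let S := subdivision_matrix D.

(** The multi-tile equation of the [k]-th iterate, written as a membership
   criterion; in this form the equations for [k] and [m] compose to the one for
   [k + m]. *)
Definition self_affine (k : nat) (T : 'I_n -> set V) : Prop :=
  forall i x, T i x <-> exists j e, e \in digits A D k j i /\ T j (A ^+ k *m x - e).

Lemma multitile_self_affine k (E : 'I_n -> 'I_n -> set V) (T : 'I_n -> set V) :
  (forall i j e, E i j e <-> e \in digits A D k i j) ->
  multitile_equation (A ^+ k) E T <-> self_affine k T.
Proof.
move=> ED; split=> H i => [x|].
  have := congr1 (fun F : set V => F (A ^+ k *m x)) (H i) => /= Hi.
  split=> [Tx|[j [e [/ED eD Tj]]]].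
    have : [set A ^+ k *m x | x in T i] (A ^+ k *m x) by exists x.
    rewrite H => -[j _ [t Tt [e /ED eD te]]].
    by exists j, e; split => //; rewrite -te addrK.
  have : [set A ^+ k *m x | x in T i] (A ^+ k *m x).
    by rewrite H; exists j => //; exists (A ^+ k *m x - e) => //; exists e; rewrite ?subrK.
  by case=> y Ty /(can_inj (expr_mulmxK hA k)) <-.
apply/seteqP; split=> [_ [x /H[j [e [/ED eD Tj]]] <-]|y [j _ [t Tt [e /ED eD <-]]]].
  by exists j => //; exists (A ^+ k *m x - e) => //; exists e; rewrite ?subrK.
exists (Ai ^+ k *m (t + e)); last by rewrite expr_mulmxVK.
by apply/H; exists j, e; rewrite expr_mulmxVK // addrK.
Qed.

Lemma self_affine0 T : self_affine 0 T.
Proof.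
move=> i x; split=> [Tx|[j [e []]]].
  by exists i, 0; rewrite digits0 eqxx mem_head subr0 mul1mx.
by rewrite digits0; case: eqP => // ->; rewrite inE => /eqP ->; rewrite subr0 mul1mx.
Qed.

Lemma self_affineD k m T : self_affine k T -> self_affine m T -> self_affine (k + m) T.
Proof.
move=> Hk Hm i x; split.
  move=> /Hm[l [e2 [h2 /Hk[j [e1 [h1 Tj]]]]]]; exists j, (e1 + A ^+ k *m e2).
  split; first by apply/mem_digitsD; exists l, e1, e2.
  by move: Tj; rewrite mulmxBr mulmxA -[_ *m A ^+ m]exprD opprD [- e1 - _]addrC addrA.
move=> [j [e [/mem_digitsD[l [e1 [e2 [h1 h2 ->]]]] Tj]]].
apply/Hm; exists l, e2; split=> //; apply/Hk; exists j, e1; split=> //.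
by move: Tj; rewrite mulmxBr mulmxA -[_ *m A ^+ m]exprD opprD addrA addrAC.
Qed.

Lemma self_affineM k m T : self_affine m T -> self_affine (k * m) T.
Proof.
by move=> Hm; elim: k => [|k IH]; [exact: self_affine0|rewrite mulSn; exact: self_affineD].
Qed.

Lemma self_affine1 k T : self_affine 1 T -> self_affine k T.
Proof. by move=> T1; have := self_affineM k T1; rewrite muln1. Qed.

Lemma column_nonempty i : exists j c, c \in D j i.
Proof.
have [S0 [[|k] [// k0 Sk]]] := hS.
apply: contrapT => H; have := Sk i i; rewrite exprSr -[_ * _]/(_ *m _) mxE big1 ?ltxx // => l _.
rewrite [subdivision_matrix D l i]mxE; case: (posnP (#|` D l i|)) => [->|]; first by rewrite mulr0.
by rewrite cardfs_gt0 => /fset0Pn[c cD]; case: H; exists l, c.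
Qed.

Lemma digits_column_nonempty k i : exists j e, e \in digits A D k j i.
Proof.
elim: k i => [|k IH] i; first by exists i, 0; rewrite digits0 eqxx mem_head.
have [l [c cD]] := column_nonempty i; have [j [e eD]] := IH l.
by exists j, (e + A ^+ k *m c); apply/mem_digitsS; exists l, e, c.
Qed.

Lemma primitive_power_gt0 : exists2 p, (0 < p)%N & forall m i j, (0 < m)%N ->
  0 < (S ^+ (m * p)) i j.
Proof.
have [_ [p [p0 Sp]]] := hS; exists p => // m i j m0.
by apply: primitive_expr_mul.
Qed.

Lemma self_affine_nonempty N T i : (0 < N)%N -> self_affine N T -> T i !=set0 ->
  forall j, T j !=set0.
Proof.
move=> N0 TN [x Tx] j; have [p p0 Sp] := primitive_power_gt0.
have [e eD] := digits_nonempty A (Sp N i j N0).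
exists (Ai ^+ (N * p) *m (x + e)).
rewrite mulnC in eD *; apply/(self_affineM p TN); exists i, e; split=> //.
by rewrite expr_mulmxVK // addrK.
Qed.

Lemma contraction_norm : exists (q : V -> R) (c C : R),
  [/\ 0 < c < 1, 0 < C,
      forall x y, q (x + y) <= q x + q y /\ q (- x) = q x,
      forall x, `|x| <= q x <= C * `|x|
    & forall k x, q (Ai ^+ k *m x) <= c ^+ k * q x].
Proof.
have [q [c [C [c01 C0 qD qn qA]]]] := expanding_adapted_norm hA.
exists q, c, C; split => // k x; elim: k => [|k IH]; first by rewrite !expr0 mul1r mul1mx.
rewrite exprS -[_ * _]/(_ *m _) -mulmxA; apply: (le_trans (qA _)).
by rewrite exprS -mulrA ler_wpM2l //; case/andP: c01 => /ltW.
Qed.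

Lemma contraction_cvg0 : forall e r : R, 0 < e -> exists K, forall k, (K <= k)%N ->
  forall x : V, `|x| <= r -> `|Ai ^+ k *m x| <= e.
Proof.
move=> e r e0; have [q [c [C [/andP[c0 c1] C0 qD qn qA]]]] := contraction_norm.
have : (fun k => c ^+ k * (C * r)) @ \oo --> 0 * (C * r).
  by apply: cvgM; [apply: cvg_expr; rewrite ger0_norm ?ltW|exact: cvg_cst].
rewrite mul0r => /cvgrPdist_le/(_ _ e0)[K _ HK]; exists K => k Kk x xr.
have /andP[h _] := qn (Ai ^+ k *m x); apply: (le_trans h); apply: (le_trans (qA _ _)).
have := HK k Kk; rewrite /= sub0r normrN => /(le_trans (ler_norm _)); apply: le_trans.
apply: ler_wpM2l; first by rewrite exprn_ge0 // ltW.
by have /andP[_ h'] := qn x; rewrite (le_trans h') // ler_pM2l.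
Qed.

(** [x] and a suitable point of [T' i] have [k * N]-th expansions in copies of
   [T j] and [T' j] translated by the same digit; the points themselves are then
   arbitrarily close when [k] is large. *)
Lemma self_affine_subset N (T T' : 'I_n -> set V) (r : R) : (0 < N)%N ->
  self_affine N T -> self_affine N T' ->
  (forall i x, T i x -> `|x| <= r) -> (forall i x, T' i x -> `|x| <= r) ->
  (forall i, closed (T' i)) -> (forall i, T' i !=set0) ->
  forall i, T i `<=` T' i.
Proof.
move=> N0 TN T'N Tr T'r cT' T'0 i x Tx.
apply: cT' => B /nbhs_ballP[e /= e0 xB].
have [K HK] := contraction_cvg0 (r + r) (@divr_gt0 R e 2 e0 (ltr0Sn _ _)).
have KN : (K <= K * N)%N by rewrite leq_pmulr.
have [j [f [fD Tj]]] := (self_affineM K TN i x).1 Tx.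
have [t T't] := T'0 j.
exists (Ai ^+ (K * N) *m (t + f)); split.
  by apply/(self_affineM K T'N); exists j, f; rewrite expr_mulmxVK // addrK.
apply: xB; rewrite -ball_normE /ball_ /=.
have -> : x - Ai ^+ (K * N) *m (t + f) = Ai ^+ (K * N) *m ((A ^+ (K * N) *m x - f) - t).
  by rewrite -addrA -opprD mulmxBr expr_mulmxK // [f + t]addrC.
apply: (@le_lt_trans _ _ (e / 2)); last by rewrite ltr_pdivrMr // mulr_natr mulr2n ltrDl.
apply: HK => //; rewrite (le_trans (ler_normB _ _)) // lerD //; first exact: (Tr j).
exact: (T'r j).
Qed.

Lemma compact_family_bounded (T : 'I_n -> set V) : (forall i, compact (T i)) ->
  exists2 r : R, 0 < r & forall i x, T i x -> `|x| <= r.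
Proof.
move=> cT; have H i : {r : R | 0 < r /\ forall x, T i x -> `|x| <= r}.
  by apply/cid; have [r r0 hr] := compact_col_norm_le (cT i); exists r.
exists (1 + \sum_i sval (H i)).
  by rewrite ltr_wpDr ?sumr_ge0 // => i _; case: (H i) => /= r [/ltW].
move=> i x Tx; apply: (@le_trans _ _ (sval (H i))); first by case: (H i) => /= r [_]; apply.
rewrite (bigD1 i) //= addrCA lerDl addr_ge0 ?sumr_ge0 // => j _.
by case: (H j) => /= r [/ltW].
Qed.

Lemma compact_self_affine_unique N (T T' : 'I_n -> set V) : (0 < N)%N ->
  self_affine N T -> self_affine N T' ->
  (forall i, compact (T i)) -> (forall i, compact (T' i)) ->
  (exists i, T i !=set0) -> (exists i, T' i !=set0) -> forall i, T i = T' i.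
Proof.
move=> N0 TN T'N cT cT' [i0 T0] [i1 T'0] i.
have [r r0 Tr] := compact_family_bounded cT; have [r' r'0 T'r] := compact_family_bounded cT'.
have cl (U : set V) : compact U -> closed U by apply: compact_closed; exact: norm_hausdorff.
apply/seteqP; split; apply: (@self_affine_subset N _ _ (r + r')) => //.
- by move=> j x /Tr h; rewrite (le_trans h) // lerDl ltW.
- by move=> j x /T'r h; rewrite (le_trans h) // lerDr ltW.
- by move=> j; exact: cl.
- exact: (self_affine_nonempty N0 T'N T'0).
- by move=> j x /T'r h; rewrite (le_trans h) // lerDr ltW.
- by move=> j x /Tr h; rewrite (le_trans h) // lerDl ltW.
- by move=> j; exact: cl.
- exact: (self_affine_nonempty N0 TN T0).
Qed.

(** If a digit works for each number of expansions, then one of finitely many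
   digits works for all of them. *)
Lemma antitone_pigeonhole (I : eqType) (s : seq I) (P : nat -> I -> Prop) :
  (forall k i, P k.+1 i -> P k i) -> (forall k, exists2 i, i \in s & P k i) ->
  exists2 i, i \in s & forall k, P k i.
Proof.
move=> anti; elim: s => [|i s IH] H; first by have [j] := H 0%N; rewrite in_nil.
have [Pi|[k0 nPi]] : (forall k, P k i) \/ exists k, ~ P k i.
- have [h|h] := pselect (forall k, P k i); [by left|right].
  by apply: contrapT => h'; apply: h => k; apply: contrapT => h2; apply: h'; exists k.
- by exists i; rewrite ?mem_head.
have anti' j k m : P (k + m)%N j -> P k j.
  by elim: m => [|m IHm]; rewrite ?addn0 // addnS => /anti.
have [k|j js Pj] := IH; last by exists j; rewrite // in_cons js orbT.
have [j] := H (k0 + k)%N; rewrite in_cons => /predU1P[->|js] Pj.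
  by case: nPi; exact: anti' Pj.
by exists j => //; apply: (anti' _ _ k0); rewrite addnC.
Qed.

(** The tiles are intersections of a decreasing sequence of compact sets: the
   points whose [k]-th expansion stays within a ball that the inverse of the
   inflation maps into itself. *)
Lemma compact_self_affine_exists :
  exists T : 'I_n -> set V, [/\ self_affine 1 T, forall i, T i !=set0 & forall i, compact (T i)].
Proof.
have [q [c [C [/andP[c0 c1] C0 qD qn qA]]]] := contraction_norm.
have q0 x : 0 <= q x by have /andP[h _] := qn x; rewrite (le_trans _ h).
pose M := \sum_i \sum_j \sum_(e <- (D i j : seq V)) q e.
have MP i j e : e \in D i j -> q e <= M.
  move=> eD; rewrite /M (bigD1 i) //= (bigD1 j) //= (big_rem e) //= -!addrA lerDl.
  have h k l : 0 <= \sum_(e <- (D k l : seq V)) q e by apply: sumr_ge0.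
  by rewrite !addr_ge0 ?sumr_ge0 // => k _; rewrite sumr_ge0.
(* The fixed point of [r |-> c * (r + M)]: the ball of radius [r] absorbs a digit
   followed by a contraction. *)
pose r := c * M / (1 - c).
have M0 : 0 <= M by apply: sumr_ge0 => i _; apply: sumr_ge0 => j _; apply: sumr_ge0.
have r0 : 0 <= r by rewrite divr_ge0 ?subr_ge0 ?mulr_ge0 // ltW.
have rE : c * (r + M) = r by rewrite /r; field; rewrite subr_eq0 eq_sym lt_eqF.
pose P k i : set V := [set x | exists j e, e \in digits A D k j i /\ q (A ^+ k *m x - e) <= r].
have qcont : continuous q.
  apply: (@continuous_of_lipschitz R V R^o q C) => x y.
  apply: (@le_trans _ _ (q (x - y))); last by have /andP[] := qn (x - y).
  rewrite ler_norml; apply/andP; split.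
    have := (qD (y - x) x).1; rewrite subrK -opprB (qD (x - y) 0).2; lra.
  by have := (qD (x - y) y).1; rewrite subrK; lra.
have Pdec k i x : P k.+1 i x -> P k i x.
  move=> [j [e [/(@mem_digitsD _ _ _ A D 1 k)[l [e1 [e2 [/mem_digits1 h1 h2 ->]]]] qx]]].
  exists l, e2; split=> //.
  have -> : A ^+ k *m x - e2 = Ai ^+ 1 *m ((A ^+ k.+1 *m x - (e1 + A ^+ 1 *m e2)) + e1).
    rewrite opprD addrA addrAC subrK.
    by rewrite (exprS A k) -[A * _]/(A *m _) -mulmxA -[in A *m _](expr1 A) -mulmxBr expr_mulmxK.
  apply: (le_trans (qA _ _)); rewrite expr1 -rE ler_wpM2l ?(ltW c0) //.
  by apply: (le_trans (qD _ _).1); rewrite lerD // (MP _ _ _ h1).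
have Pdec' k m i x : P (k + m)%N i x -> P k i x.
  by elim: m => [|m IHm]; rewrite ?addn0 // addnS => /Pdec.
have Pcl k i : closed (P k i).
  rewrite (_ : P k i = \bigcup_(j in [set: 'I_n]) \bigcup_(e in [set` digits A D k j i])
      ((fun x => q (A ^+ k *m x - e)) @^-1` `]-oo, r]%classic)); last first.
    apply/seteqP; split=> [x [j [e [eD h]]]|x [j _ [e /= eD h]]].
      by exists j => //; exists e => //=; rewrite in_itv.
    by exists j, e; split => //; move: h; rewrite /= in_itv.
  apply: closed_bigcup => [|j _]; first exact: finite_finset.
  apply: closed_bigcup => [|e _]; first exact: finite_seq.
  apply: closed_comp; last exact: interval_closed.
  move=> x _; apply: continuous_comp; last exact: qcont.
  exact: affine_map_continuous.
have P0 k i : P k i !=set0.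
  have [j [e eD]] := digits_column_nonempty k i; exists (Ai ^+ k *m e), j, e; split=> //.
  rewrite expr_mulmxVK // subrr; have /andP[_ h] := qn 0.
  by rewrite (le_trans h) // normr0 mulr0.
have Pb i x : P 0%N i x -> `|x| <= r.
  move=> [j [e []]]; rewrite digits0; case: eqP => // _; rewrite inE => /eqP ->.
  by rewrite subr0 mul1mx; apply: le_trans; have /andP[] := qn x.
pose T i : set V := \bigcap_k P k i.
have Tcl i : closed (T i) by apply: closed_bigI => k _; exact: Pcl.
have Tb i x : T i x -> `|x| <= r by move=> /(_ 0%N I); exact: Pb.
exists T; split => [i x|i|i]; last exact: compact_col_bounded (Tb i).
  split=> [Tx|[j [e [/mem_digits1 eD Tj]]] k _].
    pose s := flatten [seq [seq (j, e) | e <- (D j i : seq V)] | j <- enum 'I_n].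
    have sP p : p \in s <-> p.2 \in D p.1 i.
      split=> [/flatten_mapP[j _ /mapP[e eD ->]]//|h].
      apply/flatten_mapP; exists p.1; first by rewrite mem_enum.
      by apply/mapP; exists p.2 => //; case: (p).
    have H k : exists2 p, p \in s & P k p.1 (A ^+ 1 *m x - p.2).
      have [j [f [/mem_digitsS[l [e1 [e2 [h1 h2 ->]]]] h]]] := Tx k.+1 I.
      exists (l, e2); first exact/sP.
      exists j, e1; split => //=; move: h.
      by rewrite mulmxBr mulmxA -[A ^+ k *m A ^+ 1]exprD addn1 opprD addrA addrAC.
    have [p /sP pD pP] := @antitone_pigeonhole _ s (fun k p => P k p.1 (A ^+ 1 *m x - p.2))
        (fun k p => @Pdec k p.1 _) H.
    by exists p.1, p.2; split; [apply/mem_digits1|move=> k _; exact: pP].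
  apply: Pdec; have [l [f [fD h]]] := Tj k I.
  exists l, (f + A ^+ k *m e); split; first by apply/mem_digitsS; exists j, f, e.
  by move: h; rewrite mulmxBr mulmxA -[A ^+ k *m A ^+ 1]exprD addn1 opprD addrA addrAC.
have [u uP] := choice (P0^~ i).
have cP : compact (P 0%N i) by apply: compact_col_bounded (Pcl 0%N i) (Pb i).
have [|x [_ xu]] := cP (u @ \oo) _.
  by exists 0%N => // k _; rewrite /=; apply: (Pdec' 0%N k); rewrite add0n.
exists x => k _; apply: Pcl => B xB; apply: xu => //.
by exists k => // m /= km; apply: (Pdec' k (m - k)%N); rewrite subnKC.
Qed.

(** Subdividing often enough, a point of [T i] is approximated by arbitrarily
   small pieces of any prescribed type [j]. *)
Lemma self_affine_small_piece (T : 'I_n -> set V) (r : R) : self_affine 1 T ->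
  (forall i x, T i x -> `|x| <= r) ->
  forall i j x (e : R), T i x -> 0 < e -> exists N f, [/\ (0 < N)%N, f \in digits A D N j i &
    forall t, T j t -> `|Ai ^+ N *m (t + f) - x| <= e].
Proof.
move=> T1 Tr i j x e Tx e0.
have [K HK] := contraction_cvg0 (r + r) e0.
have [l [f1 [f1D Tl]]] := (self_affine1 K T1 i x).1 Tx.
have [p p0 Sp] := primitive_power_gt0; have := Sp 1%N j l isT; rewrite mul1n => Spj.
have [f2 f2D] := digits_nonempty A Spj.
exists (p + K)%N, (f2 + A ^+ p *m f1); split; first by rewrite addn_gt0 p0.
  by apply/mem_digitsD => //; exists l, f2, f1.
move=> t Tt; set t' := Ai ^+ p *m (t + f2).
have Tt' : T l t' by apply/(self_affine1 p T1); exists j, f2; rewrite expr_mulmxVK // addrK.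
have -> : Ai ^+ (p + K) *m (t + (f2 + A ^+ p *m f1)) - x = Ai ^+ K *m (t' - (A ^+ K *m x - f1)).
  rewrite addnC exprD -[_ * _]/(_ *m _) -mulmxA addrA [in LHS]mulmxDr expr_mulmxK // -/t'.
  by rewrite opprB addrA mulmxBr expr_mulmxK.
by apply: HK => //; rewrite (le_trans (ler_normB _ _)) // lerD //; [exact: (Tr l)|exact: (Tr l)].
Qed.

Lemma self_affine_interior_piece (T : 'I_n -> set V) k i j e x :
  self_affine k T -> e \in digits A D k j i -> (T j)° (A ^+ k *m x - e) -> (T i)° x.
Proof.
move=> Tk eD h; have c : continuous (fun y : V => A ^+ k *m y - e).
  exact: affine_map_continuous.
have cx : nbhs x ((fun y : V => A ^+ k *m y - e) @^-1` T j) := c x _ h.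
apply: (filterS _ cx) => y Ty.
by apply/Tk; exists j, e.
Qed.

(** Pieces similar to a tile with an interior point accumulate at every point of
   every tile. *)
Lemma self_affine_closure_interior (T : 'I_n -> set V) (r : R) : self_affine 1 T ->
  (forall i x, T i x -> `|x| <= r) -> (forall i, closed (T i)) ->
  (exists j, (T j)° !=set0) -> forall i, T i = closure (T i)°.
Proof.
move=> T1 Tr cT [j [v vT]] i; apply/seteqP; split; last first.
  by apply: (subset_trans (closure_subset (@interior_subset _ _))); exact: cT.
move=> x Tx B /nbhs_ballP[e /= e0 xB].
have [N [f [_ fD H]]] := self_affine_small_piece T1 Tr j Tx (@divr_gt0 R e 2 e0 (ltr0Sn _ _)).
exists (Ai ^+ N *m (v + f)); split.
  apply: (self_affine_interior_piece (self_affine1 N T1) fD).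
  by rewrite expr_mulmxVK // addrK.
apply: xB; rewrite -ball_normE /ball_ /= distrC.
apply: le_lt_trans (H v _) _; last by rewrite ltr_pdivrMr // mulr_natr mulr2n ltrDl.
exact: interior_subset.
Qed.

End MultiTiles.

(** * Measures of the tiles *)

Section TileMeasures.
Context {R : realType} {d n : nat}.
Let K := d.+1.
Variables (A : 'M[R]_K) (D : 'I_n -> 'I_n -> {fset 'cV[R]_K}).
Hypothesis hA : expanding A.
Let V := 'cV[R]_K.
Let Ai := invmx A.
Let S := subdivision_matrix D.
Let l := `|\det A|.
Variable T : 'I_n -> set V.
Hypotheses (T1 : self_affine A D 1 T) (cT : forall i, compact (T i))
  (T0 : forall i, (0 < lebesgue_d (T i))%E).

Definition tile_measures : 'rV[R]_n := \row_i fine (lebesgue_d (T i)).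

Definition pieces (k : nat) (i : 'I_n) : seq ('I_n * V) :=
  [seq (j, e) | j <- enum 'I_n, e <- digits A D k j i].

Lemma mem_pieces k i p : (p \in pieces k i) = (p.2 \in digits A D k p.1 i).
Proof.
apply/allpairsPdep/idP => [[j [e [_ eD ->]]]//|h].
by exists p.1, p.2; split=> //; [rewrite mem_enum|case: (p)].
Qed.

Lemma tile_closed i : closed (T i).
Proof. by apply: compact_closed; [exact: norm_hausdorff|exact: cT]. Qed.

Lemma tile_caratheodory i x : (@lebesgue_d R K).-caratheodory (translate (T i) x).
Proof. exact/caratheodory_closed/closed_translate/tile_closed. Qed.

Lemma tile_measureE i : lebesgue_d (T i) = (tile_measures 0 i)%:E.
Proof.
rewrite mxE fineK // ge0_fin_numE; last exact: lebesgue_d_ge0.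
by have [r _ Tr] := compact_col_norm_le (@cT i); exact: lebesgue_d_bounded Tr.
Qed.

Lemma tile_measures_gt0 i : 0 < tile_measures 0 i.
Proof. by rewrite -lte_fin -tile_measureE. Qed.

Lemma piece_measure i x : lebesgue_d (translate (T i) x) = (tile_measures 0 i)%:E.
Proof. by rewrite lebesgue_d_translate // tile_measureE. Qed.

Lemma sum_piece_measures k i :
  \sum_(p <- pieces k i) tile_measures 0 p.1 = (tile_measures *m S ^+ k) 0 i.
Proof.
rewrite big_allpairs_dep big_enum /= [RHS]mxE; apply: eq_bigr => j _ /=.
by rewrite sum_digits_const.
Qed.

Lemma inflated_tile_pieces k i y :
  [set A ^+ k *m x | x in T i] y <-> exists2 p, p \in pieces k i & translate (T p.1) p.2 y.
Proof.
have Tk := self_affine1 k T1; split.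
  case=> x /Tk[j [e [eD Tj]]] <-; exists (j, e); first by rewrite mem_pieces.
  exact/translateP.
move=> [[j e]]; rewrite mem_pieces /= => eD /translateP Tj.
exists (Ai ^+ k *m y); last by rewrite expr_mulmxVK.
by apply/Tk; exists j, e; rewrite expr_mulmxVK.
Qed.

Lemma inflated_tile_measure k i :
  lebesgue_d [set A ^+ k *m x | x in T i] = (l ^+ k * tile_measures 0 i)%:E.
Proof.
have uA := expanding_unitmx hA.
have det k' : `|\det (A ^+ k')| = l ^+ k'.
  elim: k' => [|k' IH]; first by rewrite !expr0 det1 normr1.
  by rewrite !exprS -[A * _]/(A *m _) det_mulmx normrM IH.
rewrite lebesgue_d_linear; first by rewrite det tile_measureE -EFinM.
by rewrite unitmxE unitfE -normr_eq0 det expf_neq0 // normr_eq0 -unitfE -unitmxE.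
Qed.

Lemma expanding_det_gt0 : 0 < l.
Proof. by rewrite normr_gt0 -unitfE -unitmxE expanding_unitmx. Qed.

Lemma tile_measures_subinvariant i : l * tile_measures 0 i <= (tile_measures *m S) 0 i.
Proof.
rewrite -[S]expr1 -sum_piece_measures -[l]expr1 -lee_fin -inflated_tile_measure -sumEFin.
under eq_bigr => p _ do rewrite -(piece_measure p.1 p.2).
apply: (lebesgue_d_bigcup_seq (F := fun p => translate (T p.1) p.2)) => y.
exact: (inflated_tile_pieces 1 i y).1.
Qed.

(** When the measures are invariant, the pieces of an inflated tile fill it
   without any excess, so no two of them overlap. *)
Lemma invariant_pieces_disjoint k i p p' s : tile_measures *m S = l *: tile_measures ->
  perm_eq (pieces k i) [:: p, p' & s] ->
  lebesgue_d (translate (T p.1) p.2 `&` translate (T p'.1) p'.2) = 0%E.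
Proof.
move=> TS ps.
have TSk : tile_measures *m S ^+ k = l ^+ k *: tile_measures.
  elim: (k) => [|k' IH]; first by rewrite !expr0 mulmx1 scale1r.
  by rewrite exprSr -[S ^+ k' * S]/(_ *m S) mulmxA IH -scalemxAl TS scalerA -exprSr.
have Efin : (lebesgue_d [set A ^+ k *m x | x in T i] < +oo)%E.
  by rewrite inflated_tile_measure ltry.
have Esum : (\sum_(q <- pieces k i) lebesgue_d (translate (T q.1) q.2) <=
    lebesgue_d [set A ^+ k *m x | x in T i])%E.
  under eq_bigr do rewrite piece_measure.
  by rewrite sumEFin sum_piece_measures inflated_tile_measure TSk mxE.
apply: (outer_measure_tight_cover_null (mu := @lebesgue_d R K)
  (F := fun q => translate (T q.1) q.2) _ ps _ Efin Esum).
  by move=> q; exact: tile_caratheodory.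
by move=> y /inflated_tile_pieces.
Qed.

Lemma invariant_pieces_uniq k i : tile_measures *m S = l *: tile_measures ->
  uniq (pieces k i).
Proof.
move=> TS; apply/negPn/negP => nu.
have [p [s ps]] : exists p s, perm_eq (pieces k i) [:: p, p & s].
  elim: (pieces k i) nu => //= p r IH; rewrite negb_and negbK => /orP[pr|/IH[q [s qs]]].
    by exists p, (rem p r); rewrite perm_cons perm_to_rem.
  exists q, (p :: s); apply: (@perm_trans _ (p :: [:: q, q & s])); first by rewrite perm_cons.
  by apply/permPl; exact: (perm_catCA [:: p] [:: q; q] s).
have := invariant_pieces_disjoint TS ps; rewrite setIid piece_measure => -[h].
by have := tile_measures_gt0 p.1; rewrite h ltxx.
Qed.

End TileMeasures.

(** * Counting points of weakly uniformly discrete multisets *)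

Section PointCounts.
Context {R : realType} {d : nat}.
Let V := 'cV[R]_d.

Lemma npoints_seq_le (X : multiset R d) (B : set V) (s : seq V) : uniq s ->
  (forall x, x \in s -> B x) -> ((\sum_(x <- s) X x)%N%:R%:E <= npoints X B)%E.
Proof.
move=> us sB; apply: esum_ge; exists [set` s].
  by split; [exact: finite_seq|move=> x /sB].
by rewrite -fsbig_seq // natr_sum -sumEFin.
Qed.

Lemma npoints_le (X : multiset R d) (B : set V) (m : nat) :
  (forall s : seq V, uniq s -> (forall x, x \in s -> B x) -> (\sum_(x <- s) X x <= m)%N) ->
  (npoints X B <= m%:R%:E)%E.
Proof.
move=> H; apply: ge_ereal_sup => _ [F [fF FB] <-].
rewrite fsbig_finite //= sumEFin lee_fin -natr_sum ler_nat; apply: H; first exact: fset_uniq.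
by move=> x; rewrite in_fset_set // inE => /FB.
Qed.

Lemma norm_le_enorm (x : V) : `|x| <= enorm x.
Proof.
apply/ler_col_norm; first exact: sqrtr_ge0.
move=> i; rewrite -sqrtr_sqr /enorm; apply: ler_wsqrtr.
by rewrite (bigD1 i) //= lerDl sumr_ge0 // => j _; rewrite sqr_ge0.
Qed.

Lemma enorm_le_norm (x : V) : enorm x <= d%:R * `|x|.
Proof.
have dx : 0 <= d%:R * `|x| by rewrite mulr_ge0.
rewrite -(ger0_norm dx) -sqrtr_sqr /enorm; apply: ler_wsqrtr.
apply: (@le_trans _ _ (\sum_(i < d) `|x| ^+ 2)).
  by apply: ler_sum => i _; rewrite -[leLHS]real_normK ?num_real // lerXn2r ?nnegrE // entry_le_norm.
rewrite sumr_const card_ord exprMn -[leLHS]mulr_natl; apply: ler_wpM2r; first exact: sqr_ge0.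
by case: (d) => [|d']; rewrite ?expr0n // -[leLHS]mulr1 expr2 ler_pM2l ?ltr0n // ler1n.
Qed.

(** A ball meets boundedly many cells of a fine grid, and each cell lies in a
   ball of the radius given by weak uniform discreteness. *)
Lemma weakly_uniformly_discrete_bound (X : multiset R d) (rho : R) :
  weakly_uniformly_discrete X ->
  exists M : nat, forall (c : V) (s : seq V), uniq s ->
    (forall x, x \in s -> `|x - c| <= rho) -> (\sum_(x <- s) X x <= M)%N.
Proof.
move=> [r [m [r0 _ Xr]]].
(* The side of a cell, such that its Euclidean diameter is less than [r]. *)
pose dl : R := r / (d%:R + 1).
have dl0 : 0 < dl by rewrite divr_gt0 // ltr_wpDl.
pose L := Num.truncn ((rho + rho) / dl).
exists (#|{ffun 'I_d -> 'I_L.+1}| * m)%N => c s us sc.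
pose y (x : V) i := (x i 0 - c i 0 + rho) / dl.
pose idx (x : V) : {ffun 'I_d -> 'I_L.+1} := [ffun i => inord (Num.truncn (y x i))].
have yP x i : x \in s -> 0 <= y x i /\ (Num.truncn (y x i) <= L)%N.
  move=> /sc xc; have := le_trans (entry_le_norm (x - c) i) xc.
  rewrite !mxE ler_norml => /andP[h1 h2]; split; first by rewrite divr_ge0 ?(ltW dl0) //; lra.
  by apply: le_truncn; rewrite ler_pM2r ?invr_gt0 // lerD2r.
have same x x' : x \in s -> x' \in s -> idx x = idx x' -> enorm (x' - x) < r.
  move=> xs x's e; apply: (le_lt_trans (enorm_le_norm _)).
  apply: (@le_lt_trans _ _ (d%:R * dl)).
    apply: ler_wpM2l => //; apply/ler_col_norm; first exact: ltW.
    move=> i; have := congr1 (fun f : {ffun 'I_d -> 'I_L.+1} => val (f i)) e.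
    have [y0 yL] := yP x i xs; have [y0' yL'] := yP x' i x's.
    rewrite !ffunE /= !inordK // => et.
    have /andP[h1 h2] := truncn_itv y0; have /andP[h3 h4] := truncn_itv y0'.
    rewrite -et in h3 h4; rewrite -natr1 in h2 h4.
    have -> : (x' - x) i 0 = (y x' i - y x i) * dl.
      by rewrite !mxE /y -mulrBl divfK ?lt0r_neq0 //; ring.
    by rewrite normrM (gtr0_norm dl0) ler_piMl ?(ltW dl0) // ler_norml; apply/andP; split; lra.
  rewrite /dl mulrA ltr_pdivrMr ?ltr_wpDl // mulrC ltr_pM2l // ltrDl //.
rewrite (partition_big idx xpredT) //= -sum_nat_const; apply: leq_sum => f _.
rewrite -big_filter; set t := seq.filter _ _.
case tE : t => [|x t']; first by rewrite big_nil.
rewrite -tE.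
have xt : x \in t by rewrite tE mem_head.
have mt z : z \in t -> z \in s /\ idx z = f by rewrite mem_filter => /andP[/eqP].
have [xs xf] := mt _ xt.
rewrite -(ler_nat R) -lee_fin; apply: le_trans (Xr x); apply: npoints_seq_le.
  by rewrite filter_uniq.
by move=> z /mt[zs zf]; apply: same; rewrite ?xf ?zf.
Qed.

Lemma weakly_uniformly_discrete_finite (X : multiset R d) (rho : R) :
  weakly_uniformly_discrete X ->
  exists s : seq V, forall x, (0 < X x)%N -> `|x| <= rho -> x \in s.
Proof.
move=> /(weakly_uniformly_discrete_bound rho)[M HM].
have [fin|inf] := pselect (finite_set [set x : V | (0 < X x)%N /\ `|x| <= rho]).
  by have /finite_seqP[s sE] := fin; exists s => x x0 xr; have : [set` s] x by rewrite -sE.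
have [B Bx MB] := infinite_set_fset M.+1 inf.
have := HM 0 B (fset_uniq B); rewrite leqNgt.
have -> : (M < \sum_(x <- B) X x)%N.
  apply: (leq_trans MB); rewrite cardfE -sum1_card.
  rewrite big_seq_fsetE /=; apply: leq_sum => x _.
  by have [] := Bx (val x) (valP x).
by move=> h; have : ~~ true by apply: h => x /Bx[_]; rewrite subr0.
Qed.

Lemma relatively_dense_norm (X : multiset R d) : relatively_dense X ->
  exists2 r : R, 0 < r & forall c : V, exists x, `|x - c| <= r /\ (0 < X x)%N.
Proof.
move=> [r [r0 H]]; exists r => // c; have [x [xc Xx]] := H c; exists x; split=> //.
exact: le_trans (norm_le_enorm _) xc.
Qed.

End PointCounts.

(** A finite union of closed sets with empty interior is nowhere dense. *)
Lemma closed_dense_union_interior (U : topologicalType) (I : eqType) (s : seq I)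
    (C : I -> set U) (O : set U) : (forall i, closed (C i)) -> open O -> O !=set0 ->
  (forall O' : set U, open O' -> O' `<=` O -> O' !=set0 ->
     exists2 i, i \in s & O' `&` C i !=set0) ->
  exists2 i, i \in s & (C i)° !=set0.
Proof.
move=> cC; elim: s O => [|i s IH] O oO O0 H.
  by have [j] := H O oO (fun x => id) O0; rewrite in_nil.
have [OC|nOC] := pselect (O `<=` C i).
  exists i; first exact: mem_head.
  by case: O0 => x Ox; exists x; apply: (filterS OC); exact: open_nbhs_nbhs.
have oOC : open (O `\` C i) by rewrite setDE; apply: openI => //; exact: closed_openC.
have [||j js jC] := IH (O `\` C i) oOC.
- have [x [Ox Cx]] : exists x, O x /\ ~ C i x.
    apply: contrapT => h; apply: nOC => x Ox; apply: contrapT => Cx; apply: h; by exists x.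
  by exists x.
- move=> O' oO' O'O O'0; have [|j] := H O' oO' _ O'0; first by move=> x /O'O[].
  rewrite in_cons => /predU1P[->|js] h; last by exists j.
  by case: h => x [/O'O[_ nC] Cx].
by exists j; rewrite // in_cons js orbT.
Qed.

(** * Families fixed by an inflation *)

Section InflationFixedPoints.
Context {R : realType} {d n : nat}.
Variables (A : 'M[R]_d) (D : 'I_n -> 'I_n -> {fset 'cV[R]_d}).
Hypothesis hA : expanding A.
Let V := 'cV[R]_d.
Let Ai := invmx A.

Lemma iter_fixed_mul (N k : nat) (X : 'I_n -> multiset R d) :
  iter N (inflation A D) X = X -> iter (k * N) (inflation A D) X = X.
Proof. by move=> XN; elim: k => // k IH; rewrite mulSn iterD IH. Qed.

Lemma inflation_child k (X : 'I_n -> multiset R d) i j y e :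
  (0 < X j y)%N -> e \in digits A D k i j ->
  (0 < iter k (inflation A D) X i (A ^+ k *m y + e)%R)%N.
Proof.
move=> Xy eD; rewrite (iter_inflation D hA) (bigD1 j) //= addn_gt0; apply/orP; left.
by rewrite (big_rem e) //= addrK expr_mulmxK // addn_gt0 Xy.
Qed.

Lemma inflation_parent k (X : 'I_n -> multiset R d) i x :
  (0 < iter k (inflation A D) X i x)%N ->
  exists j e, e \in digits A D k i j /\ (0 < X j (Ai ^+ k *m (x - e))%R)%N.
Proof.
rewrite (iter_inflation D hA) lt0n => H; apply: contrapT => H'.
move/negP: H; apply; rewrite big1 // => j _; rewrite big_seq big1 // => e eD.
by apply/eqP; rewrite -leqn0 leqNgt; apply/negP => h; apply: H'; exists j, e.
Qed.

End InflationFixedPoints.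

(** * From weak Delone families to tiles *)

Section DeloneFamilyToTiles.
Context {R : realType} {d n : nat}.
Let K := d.+1.
Variables (A : 'M[R]_K) (D : 'I_n -> 'I_n -> {fset 'cV[R]_K}).
Hypotheses (hA : expanding A) (hS : primitive (subdivision_matrix D)) (hn : (0 < n)%N).
Let V := 'cV[R]_K.
Let Ai := invmx A.
Variable T : 'I_n -> set V.
Hypotheses (T1 : self_affine A D 1 T) (cT : forall i, compact (T i))
  (T0 : forall i, T i !=set0).
Variables (N : nat) (X : 'I_n -> multiset R K).
Hypotheses (N0 : (0 < N)%N) (XN : weak_delone_family A D N X).

Let Xfix k : iter (k * N) (inflation A D) X = X.
Proof. exact/iter_fixed_mul/XN.1. Qed.

(** Inflation by [A^N] maps the union of the translated tiles onto itself and
   is expanding, so bounded gaps in the union are arbitrarily small gaps. *)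
Lemma translated_tiles_dense (y : V) (e : R) : 0 < e ->
  exists i x p, [/\ (0 < X i x)%N, T i (p - x) & `|p - y| <= e].
Proof.
move=> e0; pose i0 := Ordinal hn.
have [r r0 Tr] := compact_family_bounded cT.
have [rho rho0 Xrho] := relatively_dense_norm (XN.2 i0).2.
have [k Hk] := contraction_cvg0 hA (r + rho) e0.
have kN : (k <= k * N)%N by rewrite leq_pmulr.
have [x [xz Xx]] := Xrho (A ^+ (k * N) *m y).
have [t Tt] := T0 i0.
have := Xx; rewrite -{1}(Xfix k) => /(inflation_parent hA)[j [f [fD Xx']]].
exists j, (Ai ^+ (k * N) *m (x - f)), (Ai ^+ (k * N) *m (t + x)); split => //.
  apply/(self_affine1 (k * N) T1); exists i0, f; split=> //.
  by rewrite -mulmxBr expr_mulmxVK // -addrA -opprD subrK addrK.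
have -> : Ai ^+ (k * N) *m (t + x) - y = Ai ^+ (k * N) *m (t + x - A ^+ (k * N) *m y).
  by rewrite mulmxBr expr_mulmxK.
apply: Hk => //; rewrite -addrA (le_trans (ler_normD _ _)) // lerD //; exact: Tr Tt.
Qed.

(** Only finitely many translated tiles meet the unit ball, and they are dense
   in it, so one of them has an interior point. *)
Lemma tiles_closure_interior i : T i = closure (T i)°.
Proof.
have [r r0 Tr] := compact_family_bounded cT.
have clT j : closed (T j) by apply: compact_closed; [exact: norm_hausdorff|exact: cT].
apply: (self_affine_closure_interior hA hS T1 Tr clT).
have H j : {s : seq V | forall x, (0 < X j x)%N -> `|x| <= 1 + r -> x \in s}.
  apply/cid/weakly_uniformly_discrete_finite; exact: (XN.2 j).1.
pose s := [seq (j, x) | j <- enum 'I_n, x <- sval (H j)].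
have C_closed (p : 'I_n * V) : closed (translate (T p.1) p.2) by exact: closed_translate.
have O0 : ball (0 : V) 1 !=set0 by exists 0; exact: ballxx.
have oO : open (ball (0 : V) 1) by apply: ball_open.
have [|p _ [v]] := @closed_dense_union_interior V _ s _ _ C_closed oO O0.
  move=> O' oO' O'O [y O'y].
  have [e /= e0 yO'] := (nbhs_ballP _ _).1 (open_nbhs_nbhs (conj oO' O'y)).
  have [j [x [p [Xx Tp py]]]] := translated_tiles_dense y (@divr_gt0 R e 2 e0 (ltr0Sn _ _)).
  have O'p : O' p.
    apply: yO'; rewrite -ball_normE /ball_ /= distrC (le_lt_trans py) //.
    by rewrite ltr_pdivrMr // mulr_natr mulr2n ltrDl.
  exists (j, x); last by exists p; split => //; apply/translateP.
  apply/allpairsPdep; exists j, x; split=> //; first by rewrite mem_enum.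
  case: (H j) => /= sj; apply => //.
  have -> : x = p - (p - x) by rewrite opprB addrC subrK.
  apply: (le_trans (ler_normB _ _)); apply: lerD; last exact: Tr Tp.
  by have := O'O _ O'p; rewrite -ball_normE /ball_ /= sub0r normrN => /ltW.
rewrite /interior /= => vT; exists p.1, (v - p.2).
have c : {for (v - p.2), continuous (fun y : V => 1%:M *m y - (- p.2))} by exact: affine_map_continuous.
have h : nbhs (v - p.2) ((fun y : V => 1%:M *m y - (- p.2)) @^-1` translate (T p.1) p.2).
  by apply: c; rewrite mul1mx opprK subrK.
apply: (filterS _ h) => y /= /translateP.
by rewrite mul1mx opprK addrK.
Qed.

Lemma tiles_measure_gt0 i : (0 < lebesgue_d (T i))%E.
Proof.
have [v vT] : (T i)° !=set0.
  apply: contrapT => h; have [x] := T0 i; rewrite (tiles_closure_interior i).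
  have -> : (T i)° = set0 by rewrite -subset0 => y Ty; apply: h; exists y.
  by rewrite closure0.
have [e e0 he] := interior_norm_ball vT.
exact: lebesgue_d_ball_gt0 e0 he.
Qed.

Let tau := tile_measures T.
Let S := subdivision_matrix D.
Let l := `|\det A|.

(** The multiplicity with which the pieces of an inflated tile of the family
   cover a point is bounded, by weak uniform discreteness, independently of
   the number of inflation steps. *)
Lemma tile_measures_growth_bound i :
  exists m : nat, forall k, (tau *m S ^+ (k * N)) 0 i <= m%:R * (l ^+ (k * N) * tau 0 i).
Proof.
have [r r0 Tr] := compact_family_bounded cT.
have H j : {M : nat | forall (c : V) (s : seq V), uniq s ->
    (forall x, x \in s -> `|x - c| <= r) -> (\sum_(x <- s) X j x <= M)%N}.
  by apply/cid/weakly_uniformly_discrete_bound; exact: (XN.2 j).1.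
exists (\sum_j sval (H j))%N => k.
have [rho _ Xdense] := relatively_dense_norm (XN.2 i).2.
have [x [_ Xx]] := Xdense 0.
pose z := A ^+ (k * N) *m x.
pose E : set V := translate [set A ^+ (k * N) *m x | x in T i] z.
pose F (p : 'I_n * V) : set V := translate (T p.1) (p.2 + z).
have EF p : p \in pieces A D (k * N) i -> F p `<=` E.
  move=> pP y /translateP Ty; apply/translateP; apply/(inflated_tile_pieces hA T1).
  by exists p => //; apply/translateP; rewrite -addrA -opprD [z + _]addrC.
have mult y : E y -> (\sum_(p <- pieces A D (k * N) i) `[< F p y >] <= \sum_j sval (H j))%N.
  move=> _; rewrite big_allpairs_dep big_enum /=; apply: leq_sum => j _.
  pose s := [seq e + z | e <- digits A D (k * N) j i & `[< F (j, e) y >]].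
  have -> : (\sum_(e <- digits A D (k * N) j i) `[< F (j, e) y >] = size s)%N.
    by rewrite size_map size_filter -sum1_count [RHS]big_mkcond.
  have sy w : w \in s -> `|w - y| <= r.
    move=> /mapP[e]; rewrite mem_filter => /andP[/asboolP/translateP Ty _] ->.
    by rewrite distrC; exact: Tr Ty.
  case: (H j) => M /= HM; apply: leq_trans (HM y (undup s) (undup_uniq _) _); last first.
    by move=> w; rewrite mem_undup; exact: sy.
  have -> : size s = (\sum_(w <- undup s) count_mem w s)%N.
    rewrite -(perm_size (perm_count_undup s)) size_flatten sumnE /shape -map_comp big_map.
    by apply: eq_bigr => w _; rewrite /= size_nseq.
  apply: leq_sum => w _.
  rewrite -[in leqRHS](Xfix k) (iter_inflation D hA) (bigD1 i) //=.
  apply: leq_trans (leq_addr _ _).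
  rewrite count_map count_filter -sum1_count big_mkcond /=.
  apply: leq_sum => e _; case: ifPn => // /andP[/eqP <- _].
  by rewrite addrC addKr expr_mulmxK.
have : (\sum_(p <- pieces A D (k * N) i) lebesgue_d (E `&` F p) <=
    (\sum_j sval (H j))%N%:R%:E * lebesgue_d E)%E.
  apply: (caratheodory_sum_le_multiplicity (mu := @lebesgue_d R K) _ mult) => p.
  exact: tile_caratheodory.
have -> : lebesgue_d E = (l ^+ (k * N) * tau 0 i)%:E.
  by rewrite lebesgue_d_translate // inflated_tile_measure.
have EFm p : p \in pieces A D (k * N) i -> lebesgue_d (E `&` F p) = (tau 0 p.1)%:E.
  by move=> pP; rewrite (setIidr (EF p pP)); exact: piece_measure.
rewrite big_seq (eq_bigr _ EFm).
by rewrite -big_seq sumEFin sum_piece_measures -EFinM lee_fin.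
Qed.

(** Growth at a rate larger than [l] would contradict the bounded multiplicity. *)
Lemma tile_measures_invariant : tau *m S = l *: tau.
Proof.
have l0 : 0 < l := expanding_det_gt0 hA.
have t0 := tile_measures_gt0 cT tiles_measure_gt0.
apply: contrapT => ne.
have [rho [c [m0 [lrho c0 grow]]]] := subinvariant_growth hS t0 l0
  (tile_measures_subinvariant hA T1 cT) ne.
pose i0 := Ordinal hn.
have [m Hm] := tile_measures_growth_bound i0.
have rho0 : 0 < rho := lt_trans l0 lrho.
have : (fun k => (l / rho) ^+ k * (m%:R * tau 0 i0)) @ \oo --> 0 * (m%:R * tau 0 i0).
  apply: cvgM; last exact: cvg_cst.
  by apply: cvg_expr; rewrite ger0_norm ?divr_ge0 ?(ltW l0) ?(ltW rho0) // ltr_pdivrMr // mul1r.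
rewrite mul0r => /cvgrPdist_lt /(_ _ c0)[k0 _ Hk0].
pose k := (m0 + k0)%N.
have kN : (k <= k * N)%N by rewrite leq_pmulr.
have := Hk0 (k * N)%N (leq_trans (leq_addl _ _) kN).
rewrite /= sub0r normrN => /(le_lt_trans (ler_norm _)).
rewrite ltNge => /negP; apply.
rewrite expr_div_n mulrAC ler_pdivlMr ?exprn_gt0 //.
apply: (le_trans (grow _ i0 (leq_trans (leq_addr _ _) kN))).
by apply: (le_trans (Hm k)); rewrite mulrCA.
Qed.

End DeloneFamilyToTiles.

(** * From tiles to a self-replicating multi-tiling *)

(** If the measures were not invariant, they would grow under [S] faster than
   the spectral radius allows. *)
Lemma spectral_radius_tile_measures_invariant (R : realType) (d n : nat)
    (A : 'M[R]_d.+1) (D : 'I_n -> 'I_n -> {fset 'cV[R]_d.+1}) (T : 'I_n -> set 'cV[R]_d.+1) :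
  expanding A -> primitive (subdivision_matrix D) -> (0 < n)%N ->
  self_affine A D 1 T -> (forall i, compact (T i)) -> (forall i, (0 < lebesgue_d (T i))%E) ->
  `|\det A| = spectral_radius (subdivision_matrix D) ->
  tile_measures T *m subdivision_matrix D = `|\det A| *: tile_measures T.
Proof.
move=> hA hS hn T1 cT T0 lS; set l := `|\det A|; set S := subdivision_matrix D.
set tau := tile_measures T.
have l0 : 0 < l := expanding_det_gt0 hA.
apply: contrapT => ne.
have [rho [c [m0 [lrho c0 grow]]]] := subinvariant_growth hS (tile_measures_gt0 cT T0) l0
  (tile_measures_subinvariant hA T1 cT) ne.
have rho0 : 0 < rho := lt_trans l0 lrho.
pose i0 := Ordinal hn.
have Srho z : complex_eigenvalue S z -> Normc.normc z < rho.
  by move=> /complex_eigenvalue_le_spectral_radius h; apply: le_lt_trans lrho; rewrite /l lS.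
have : (fun m => \sum_i tau 0 i * ((S ^+ m) i i0 / rho ^+ m)) @ \oo --> \sum_(i < n) tau 0 i * 0.
  have := @cvg_big R 'I_n +%R (0 : R) xpredT add_continuous nat \oo (index_enum 'I_n)
    (fun i m => tau 0 i * ((S ^+ m) i i0 / rho ^+ m)) (fun i => tau 0 i * 0) _; apply => i _.
  by apply: cvgM; [exact: cvg_cst|exact: powers_small_spectrum].
under [X in _ --> X]eq_bigr do rewrite mulr0.
rewrite big1 // => /cvgrPdist_lt /(_ _ c0)[k0 _ Hk0].
have := Hk0 (m0 + k0)%N (leq_addl _ _); rewrite /= sub0r normrN => /(le_lt_trans (ler_norm _)).
rewrite ltNge => /negP; apply.
under eq_bigr do rewrite mulrA.
rewrite -mulr_suml ler_pdivlMr ?exprn_gt0 //.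
by apply: (le_trans (grow _ i0 (leq_addr k0 m0))); rewrite mxE.
Qed.

Section TilesToDeloneFamily.
Context {R : realType} {d n : nat}.
Let K := d.+1.
Variables (A : 'M[R]_K) (D : 'I_n -> 'I_n -> {fset 'cV[R]_K}).
Hypotheses (hA : expanding A) (hS : primitive (subdivision_matrix D)) (hn : (0 < n)%N).
Let V := 'cV[R]_K.
Let Ai := invmx A.
Variable T : 'I_n -> set V.
Hypotheses (T1 : self_affine A D 1 T) (cT : forall i, compact (T i))
  (T0 : forall i, (0 < lebesgue_d (T i))%E) (Tint : forall i, (T i)° !=set0).
Let S := subdivision_matrix D.
Let tau := tile_measures T.
Hypothesis TS : tau *m S = `|\det A| *: tau.

(** [1 - A^-N] is invertible, since a vector fixed by the powers of [A^-N] is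
   zero. *)
Lemma expanding_fixed_point N (e : V) : (0 < N)%N -> exists x, x = A ^+ N *m x + e.
Proof.
move=> N0; pose M : 'M[R]_K := 1%:M - Ai ^+ N.
have Minj (v : V) : M *m v = 0 -> v = 0.
  rewrite mulmxBl mul1mx => /subr0_eq vE.
  have vk k : v = Ai ^+ (k * N) *m v.
    by elim: k => [|k IH]; rewrite ?mul1mx // mulSn exprD -[_ * _]/(_ *m _) -mulmxA -IH.
  apply/eqP; rewrite -normr_le0; apply/ler_addgt0Pl => f f0; rewrite addr0.
  have [k Hk] := contraction_cvg0 hA `|v| f0.
  by rewrite (vk k) Hk // leq_pmulr.
have uM : M \in unitmx.
  rewrite -unitmx_tr -row_free_unit -kermx_eq0; apply/eqP/row_matrixP => i; rewrite row0.
  set w := row i _; rewrite -[LHS]trmxK [w^T]Minj ?trmx0 //.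
  by rewrite -[M]trmxK -trmx_mul /w -row_mul mulmx_ker row0 trmx0.
exists (- (invmx M *m (Ai ^+ N *m e))); set x := - _.
have : M *m x = - (Ai ^+ N *m e) by rewrite /x mulmxN mulKVmx.
rewrite mulmxBl mul1mx => /eqP; rewrite subr_eq => /eqP xE.
by rewrite {2}xE mulmxDr mulmxN !expr_mulmxVK // addrC addNKr.
Qed.

(** A piece of type [i0] that lies well inside an inflated tile of type [i0]
   gives a fixed point [x0] and an exponent [N] such that the tile at [x0]
   reappears in its own [N]-th subdivision; the inflated copies of this tile
   then exhaust space. *)
Lemma self_reproducing_tile (i0 : 'I_n) : exists N e0 (x0 : V) (rho : R),
  [/\ (0 < N)%N, e0 \in digits A D N i0 i0, x0 = A ^+ N *m x0 + e0, 0 < rho &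
     forall y, `|y| <= rho -> T i0 (y - x0)].
Proof.
have [r r0 Tr] := compact_family_bounded cT.
have [p pT] := Tint i0; have [e e0 eT] := interior_norm_ball pT.
have e40 : 0 < e / 4 by rewrite divr_gt0.
have [N [f [N0 fD Hf]]] := self_affine_small_piece hA hS T1 Tr i0 (interior_subset pT) e40.
have [x0 x0E] := expanding_fixed_point f N0.
(* The orbit of the tile at [x0] under [A^-N] tends to the origin and stays in
   the ball of radius [e / 4] about [x0 + p], which puts the origin itself within
   [e / 2] of [x0 + p]. *)
exists N, f, x0, (e / 4); split => // y ye; apply: eT.
have step t : T i0 t -> T i0 (Ai ^+ N *m (t + f)).
  by move=> Tt; apply/(self_affine1 N T1); exists i0, f; rewrite expr_mulmxVK // addrK.
have x0E' : x0 = Ai ^+ N *m (x0 - f) by rewrite {2}x0E addrK expr_mulmxK.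
have shift w : Ai ^+ N *m w - x0 = Ai ^+ N *m (w - x0 + f).
  by rewrite {1}x0E' -mulmxBr opprB addrA addrAC.
have orbit k t : T i0 t -> T i0 (Ai ^+ (k * N) *m (t + x0) - x0).
  elim: k t => [|k IH] t Tt; first by rewrite mul1mx addrK.
  have -> : Ai ^+ (k.+1 * N) *m (t + x0) - x0 = Ai ^+ N *m ((Ai ^+ (k * N) *m (t + x0) - x0) + f).
    by rewrite -shift mulSn exprD mulmxA.
  exact/step/IH.
have px0 : `|x0 + p| <= e / 4 + e / 4.
  have [k Hk] := contraction_cvg0 hA (r + `|x0|) e40.
  have Tp := interior_subset pT.
  have kN : (k <= k.+1 * N)%N by rewrite (leq_trans (leqnSn k)) // leq_pmulr.
  have h1 := Hk _ kN (p + x0) (le_trans (ler_normD _ _) (lerD (Tr _ _ Tp) (lexx _))).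
  have h2 := Hf _ (orbit k p Tp).
  have E : Ai ^+ N *m ((Ai ^+ (k * N) *m (p + x0) - x0) + f) = Ai ^+ (k.+1 * N) *m (p + x0) - x0.
    by rewrite -shift mulSn exprD mulmxA.
  rewrite E in h2.
  have -> : x0 + p = Ai ^+ (k.+1 * N) *m (p + x0) - (Ai ^+ (k.+1 * N) *m (p + x0) - x0 - p).
    by move: (Ai ^+ _ *m _) => a; rewrite -addrA -opprD opprB [RHS]addrC subrK.
  by apply: (le_trans (ler_normB _ _)); apply: lerD.
have -> : y - x0 - p = y - (x0 + p) by rewrite opprD addrA.
apply: (le_trans (ler_normB _ _)); lra.
Qed.

Section Patch.
Variables (i0 : 'I_n) (N : nat) (e0 x0 : V) (rho : R).
Hypotheses (N0 : (0 < N)%N) (e0D : e0 \in digits A D N i0 i0)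
  (x0E : x0 = A ^+ N *m x0 + e0) (rho0 : 0 < rho)
  (x0T : forall y, `|y| <= rho -> T i0 (y - x0)).

Definition seed : 'I_n -> multiset R K := fun i x => (i == i0) && (x == x0).

(** The points of type [i] in the [k * N]-th inflation of the seed. *)
Definition in_patch (k : nat) (i : 'I_n) (x : V) : bool :=
  x - A ^+ (k * N) *m x0 \in digits A D (k * N) i i0.

Definition limit_family : 'I_n -> multiset R K := fun i x => `[< exists k, in_patch k i x >].

(** The digits of an iterate have no repetitions, because two pieces at the same
   place would overlap in a set of positive measure. *)
Lemma iter_seed k i x : iter (k * N) (inflation A D) seed i x = in_patch k i x.
Proof.
rewrite (iter_inflation D hA) (bigD1 i0) //= [X in (_ + X)%N]big1 ?addn0 => [|j /negbTE ji]; last first.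
  by rewrite big1 // => e _; rewrite /seed ji.
have ud : uniq (digits A D (k * N) i i0).
  have up : uniq (pieces A D (k * N) i0) by exact: (invariant_pieces_uniq hA T1 cT T0).
  move: up.
  have -> : digits A D (k * N) i i0 = [seq p.2 | p <- pieces A D (k * N) i0 & p.1 == i].
    rewrite /pieces; have := enum_uniq 'I_n; have : i \in enum 'I_n by rewrite mem_enum.
    have other (s : seq 'I_n) : i \notin s ->
        [seq p <- [seq (j, e) | j <- s, e <- digits A D (k * N) j i0] | p.1 == i] = [::].
      elim: s => //= j s IH; rewrite in_cons negb_or eq_sym => /andP[/negbTE ji /IH iS].
      by rewrite filter_cat iS cats0; elim: (digits _ _ _ _ _) => //= e s' ->; rewrite ji.
    elim: (enum 'I_n) => //= j s IH; rewrite in_cons filter_cat map_cat => /orP[/eqP <-|iS] /andP[js us].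
      rewrite other // cats0; elim: (digits _ _ _ _ _) => //= e s' {1}->.
      by rewrite eqxx.
    rewrite -(IH iS us); have /negbTE ji : j != i by apply: contraNneq js => ->.
    by elim: (digits A D (k * N) j i0) => //= e s' IHs; rewrite ji.
  move=> up; rewrite map_inj_in_uniq ?filter_uniq // => -[a b] [a' b'].
  by rewrite !mem_filter /= => /andP[/eqP -> _] /andP[/eqP -> _] ->.
rewrite /in_patch -(count_uniq_mem _ ud) -sum1_count [RHS]big_mkcond /=.
apply: eq_bigr => e _; rewrite /seed eqxx /=.
have -> : (Ai ^+ (k * N) *m (x - e) == x0) = (e == x - A ^+ (k * N) *m x0).
  apply/eqP/eqP => [<-|->]; first by rewrite expr_mulmxVK // opprB addrC subrK.
  by rewrite opprB addrC subrK expr_mulmxK.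
by case: eqP.
Qed.

(** The tile at [x0] is a piece of its own expansion, so each patch contains the
   previous one. *)
Lemma in_patch_mono k k' i x : (k <= k')%N -> in_patch k i x -> in_patch k' i x.
Proof.
move=> /subnKC <-; elim: (k' - k)%N => [|m IH]; rewrite ?addn0 // addnS => /IH.
set h := (k + m)%N; rewrite /in_patch => xD.
have -> : x - A ^+ (h.+1 * N) *m x0 = (x - A ^+ (h * N) *m x0) + A ^+ (h * N) *m e0.
  rewrite mulSn addnC exprD -[_ * _]/(_ *m _) -mulmxA.
  have -> : A ^+ N *m x0 = x0 - e0 by rewrite {2}x0E addrK.
  by rewrite mulmxBr opprB addrA addrAC.
by rewrite mulSn addnC; apply/mem_digitsD; exists i0, (x - A ^+ (h * N) *m x0), e0.
Qed.

Lemma limit_family_gt0 i x : (0 < limit_family i x)%N <-> exists k, in_patch k i x.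
Proof. by rewrite /limit_family lt0b; split => /asboolP. Qed.

(** The value at one point of an inflated family depends on finitely many values
   of the family; on these a late patch agrees with the limit. *)
Lemma limit_family_stable (s : seq ('I_n * V)) :
  exists k0, forall k, (k0 <= k)%N -> forall p, p \in s ->
    limit_family p.1 p.2 = in_patch k p.1 p.2.
Proof.
elim: s => [|p s [k0 IH]]; first by exists 0%N.
have [k1 Hk1] : exists k1, forall k, (k1 <= k)%N -> limit_family p.1 p.2 = in_patch k p.1 p.2.
  have [[k1 k1P]|H] := pselect (exists k, in_patch k p.1 p.2).
    exists k1 => k k1k; rewrite (in_patch_mono k1k k1P) /limit_family.
    by apply/eqP; rewrite eqb1; apply/asboolP; exists k1.
  exists 0%N => k _; rewrite /limit_family; case: asboolP => // _.
  by case kP : (in_patch k _ _) => //; case: H; exists k.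
exists (k0 + k1)%N => k kk q; rewrite in_cons => /predU1P[->|qs].
  by apply: Hk1; apply: leq_trans kk; rewrite leq_addl.
by apply: IH => //; apply: leq_trans kk; rewrite leq_addr.
Qed.

Lemma limit_family_fixed : iter N (inflation A D) limit_family = limit_family.
Proof.
apply/funext => i; apply/funext => x.
pose s := (i, x) :: flatten [seq [seq (j, Ai ^+ N *m (x - e)) | e <- digits A D N i j] | j <- enum 'I_n].
have [k Hk] := limit_family_stable s.
rewrite (Hk k.+1 (leqnSn k) (i, x) (mem_head _ _)) -iter_seed mulSn iterD !(iter_inflation D hA) /=.
apply: eq_bigr => j _; rewrite big_seq [RHS]big_seq; apply: eq_bigr => e eD.
rewrite iter_seed; apply: (Hk k (leqnn k) (j, Ai ^+ N *m (x - e))).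
rewrite in_cons; apply/orP; right; apply/flatten_mapP; exists j; first by rewrite mem_enum.
by apply/mapP; exists e.
Qed.

(** Contracted far enough, [y] enters the ball around the origin that the tile at
   [x0] contains. *)
Lemma limit_family_covers y : exists i x, (0 < limit_family i x)%N /\ translate (T i) x y.
Proof.
have [k Hk] := contraction_cvg0 hA `|y| rho0.
have kN : (k <= k * N)%N by rewrite leq_pmulr.
have := x0T (Hk _ kN y (lexx _)).
move=> /(self_affine1 (k * N) T1)[j [e [eD Tj]]].
exists j, (A ^+ (k * N) *m x0 + e); split.
  by apply/limit_family_gt0; exists k; rewrite /in_patch addrAC subrr add0r.
apply/translateP; move: Tj.
by rewrite mulmxBr expr_mulmxVK // opprD addrA.
Qed.

Lemma limit_family_disjoint i x j y : (0 < limit_family i x)%N -> (0 < limit_family j y)%N ->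
  (i, x) <> (j, y) -> lebesgue_d (translate (T i) x `&` translate (T j) y) = 0%E.
Proof.
move=> /limit_family_gt0[k kP] /limit_family_gt0[k' k'P] ne.
have {}kP := in_patch_mono (leq_addr k' k) kP.
have {}k'P := in_patch_mono (leq_addl k k') k'P.
set m := (k + k')%N in kP k'P.
pose z := A ^+ (m * N) *m x0.
pose p : 'I_n * V := (i, x - z); pose q : 'I_n * V := (j, y - z).
have pP : p \in pieces A D (m * N) i0 by rewrite mem_pieces.
have qP : q \in pieces A D (m * N) i0 by rewrite mem_pieces.
have qp : q != p by apply/eqP => -[ji] /addIr yx; apply: ne; rewrite ji yx.
have pq : perm_eq (pieces A D (m * N) i0) [:: p, q & rem q (rem p (pieces A D (m * N) i0))].
  apply: (perm_trans (perm_to_rem pP)); rewrite perm_cons; apply: perm_to_rem.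
  by have := perm_mem (perm_to_rem pP) q; rewrite qP in_cons (negbTE qp) /= => <-.
rewrite -[RHS](invariant_pieces_disjoint hA T1 cT TS pq) -[RHS](lebesgue_d_translate z) //.
congr lebesgue_d.
apply/seteqP; split=> w.
  move=> [/translateP h1 /translateP h2]; apply/translateP; split; apply/translateP => /=.
    by rewrite opprB addrA subrK.
  by rewrite opprB addrA subrK.
move=> /translateP[/translateP /= h1 /translateP /= h2]; split; apply/translateP.
  by move: h1; rewrite opprB addrA subrK.
by move: h2; rewrite opprB addrA subrK.
Qed.

(** Two tiles of the same type at nearby points share a ball, the translate of
   one inside the tile, which contradicts disjointness. *)
Lemma limit_family_uniformly_discrete i : uniformly_discrete (limit_family i).
Proof.
have [v vT] := Tint i; have [e ee eT] := interior_norm_ball vT.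
have sep x y : (0 < limit_family i x)%N -> (0 < limit_family i y)%N -> `|x - y| <= e / 2 -> x = y.
  move=> Xx Xy xy; apply: contrapT => ne.
  have := limit_family_disjoint Xx Xy; rewrite pair_equal_spec => /(_ (fun h => ne h.2)) h.
  have : (0 < lebesgue_d (translate (T i) x `&` translate (T i) y))%E.
    apply: (@lebesgue_d_ball_gt0 _ _ _ (v + x) (e / 2)); first by rewrite divr_gt0.
    move=> w wv; split; apply/translateP; apply: eT.
      by rewrite -addrA -opprD [x + v]addrC (le_trans wv) // ler_pdivrMr // ler_peMr ?ler1n // ltW.
    have -> : w - y - v = (w - (v + x)) + (x - y) by rewrite opprD addrA addrA subrK addrAC.
    by apply: (le_trans (ler_normD _ _)); lra.
  by rewrite h ltxx.
exists (e / 4); split; first by rewrite divr_gt0.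
move=> c; apply: npoints_le => s us sc.
have [|none] := pselect (exists2 x, x \in s & (0 < limit_family i x)%N); last first.
  rewrite big_seq big1 // => x xs; apply/eqP; rewrite -leqn0 leqNgt.
  by apply/negP => h; apply: none; exists x.
move=> [x xs Xx]; rewrite (bigD1_seq x) //= big_seq_cond big1 ?addn0; first exact: leq_b1.
move=> y /andP[ys yx]; apply/eqP; rewrite -leqn0 leqNgt; apply/negP => Xy.
move/negP: yx; apply; apply/eqP; apply: sep => //.
have := le_lt_trans (norm_le_enorm _) (sc x xs); have := le_lt_trans (norm_le_enorm _) (sc y ys).
have := ler_normB (y - c) (x - c).
have -> : y - c - (x - c) = y - x by rewrite opprB addrA subrK.
lra.
Qed.

(** Each point lies in an expanded tile of a type beyond control, but by
   primitivity every expanded tile has pieces of all types. *)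
Lemma limit_family_relatively_dense i : relatively_dense (limit_family i).
Proof.
have [r r0 Tr] := compact_family_bounded cT.
have [p p0 Sp] := primitive_power_gt0 hS.
set m := (p * N)%N.
have Sm j k : 0 < (S ^+ m) j k by rewrite /m mulnC; exact: Sp.
have [C [C0 HC]] := mulmx_bounded (A ^+ m).
pose E : R := \sum_j \sum_(e <- digits A D m i j) `|e|.
have HE j e : e \in digits A D m i j -> `|e| <= E.
  move=> eD; rewrite /E (bigD1 j) //= (big_rem e) //= -addrA lerDl addr_ge0 ?sumr_ge0 // => k _.
  by rewrite sumr_ge0.
have E0 : 0 <= E by apply: sumr_ge0 => j _; apply: sumr_ge0.
exists (K%:R * (C * r + E)); split.
  by rewrite mulr_gt0 // ltr_pwDl // mulr_gt0.
move=> c; have [j [y [Xy /translateP Ty]]] := limit_family_covers (Ai ^+ m *m c).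
have [e eD] := digits_nonempty A (Sm i j).
exists (A ^+ m *m y + e); split.
  apply: (le_trans (enorm_le_norm _)); apply: ler_wpM2l => //.
  have -> : A ^+ m *m y + e - c = e - A ^+ m *m (Ai ^+ m *m c - y).
    by rewrite mulmxBr expr_mulmxVK // opprB addrAC addrC addrA.
  apply: (le_trans (ler_normB _ _)); rewrite addrC; apply: lerD; last exact: HE eD.
  by apply: (le_trans (HC _)); rewrite ler_pM2l //; exact: Tr Ty.
have := inflation_child hA Xy eD.
by rewrite iter_fixed_mul //; exact: limit_family_fixed.
Qed.

End Patch.

Lemma self_replicating_multitiling_exists :
  exists N, (0 < N)%N /\ exists X, self_replicating_multitiling A D N X.
Proof.
pose i0 := Ordinal hn.
have [N [e0 [x0 [rho [N0 e0D x0E rho0 x0T]]]]] := self_reproducing_tile i0.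
exists N; split => //; exists (limit_family i0 N x0); split.
- exact: limit_family_fixed e0D x0E.
- move=> i; split; first exact: limit_family_uniformly_discrete e0D x0E i.
  exact: limit_family_relatively_dense N0 e0D x0E rho0 x0T i.
- exists T; split => //; last first.
    split; first exact: limit_family_covers N0 rho0 x0T.
    exact: limit_family_disjoint e0D x0E.
  have eqN (T' : 'I_n -> set V) : multitile_equation (A ^+ N)
      (fun i j => [set` iterated_digits A D N i j]) T' <-> self_affine A D N T'.
    apply: multitile_self_affine => // i j e; exact: mem_iterated_digits.
  have Tne i : T i !=set0 by have [v /interior_subset vT] := Tint i; exists v.
  split; first by split; [apply/eqN; exact: self_affine1|exists i0|].
  move=> T' [/eqN T'N T'0 cT']; apply: (compact_self_affine_unique hA hS N0 T'N) => //.
    exact: self_affine1.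
  by exists i0.
Qed.

End TilesToDeloneFamily.

(** * The equivalence *)

Theorem theorem2p4 (R : realType) (d n : nat) (hd : (1 <= d)%N) (hn : (1 <= n)%N)
    (A : 'M[R]_d) (hA : expanding A)
    (D : 'I_n -> 'I_n -> {fset 'cV[R]_d})
    (hS : primitive (subdivision_matrix D)) :
  let cond_i :=
    exists N : nat, (0 < N)%N /\
      exists X : 'I_n -> multiset R d, weak_delone_family A D N X in
  let cond_ii :=
    exists N : nat, (0 < N)%N /\
      exists X : 'I_n -> multiset R d, self_replicating_multitiling A D N X in
  let cond_iii :=
    is_perron_eigenvalue (subdivision_matrix D) `|\det A| /\
    exists T : 'I_n -> set 'cV[R]_d,
      [/\ unique_compact_solution A (fun i j => [set` D i j]) T,
          forall i, (0 < lebesgue_d (T i))%E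
        & forall i, T i = closure (interior (T i))] in
  (cond_i <-> cond_ii) /\ (cond_ii <-> cond_iii).
Proof.
case: d hd A hA D hS => // d' _ A' hA' D' hS' cond_i cond_ii cond_iii.
have eq1 T : multitile_equation A' (fun i j => [set` D' i j]) T <-> self_affine A' D' 1 T.
  rewrite -[X in multitile_equation X](expr1 A').
  apply: multitile_self_affine => // i j e; split=> /mem_digits1 //.
have h21 : cond_ii -> cond_i.
  move=> [N [N0 [X [XN Xdel _]]]]; exists N; split=> //; exists X; split=> // i.
  have [[r [r0 Xr]] Xd] := Xdel i; split=> //; by exists r, 1%N.
have h13 : cond_i -> cond_iii.
  move=> [N [N0 [X XN]]].
  have [T [T1 Tne cT]] := compact_self_affine_exists hA' hS'.
  have T0 := tiles_measure_gt0 hA' hS' hn T1 cT Tne N0 XN.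
  split.
    apply: (perron_of_positive_invariant hn hS' (expanding_det_gt0 hA') (tile_measures_gt0 cT T0)).
    exact: (tile_measures_invariant hA' hS' hn T1 cT Tne N0 XN).
  exists T; split => //; last exact: (tiles_closure_interior hA' hS' hn T1 cT Tne N0 XN).
  have Tex : exists i, T i !=set0 by exists (Ordinal hn).
  split; first by split => //; exact/eq1.
  move=> T' [/eq1 T'1 T'0 cT']; exact: (compact_self_affine_unique hA' hS' (isT : (0 < 1)%N) T'1 T1).
have h32 : cond_iii -> cond_ii.
  move=> [[_ _ _ lS] [T [[[/eq1 T1 Tex cT] _] T0 Tcl]]].
  have Tint i : (T i)° !=set0.
    apply: contrapT => h; have := T0 i; rewrite (Tcl i).
    have -> : (T i)° = set0 by rewrite -subset0 => x Tx; apply: h; exists x.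
    by rewrite closure0 lebesgue_d0 // ltxx.
  apply: (self_replicating_multitiling_exists hA' hS' hn T1 cT T0 Tint).
  exact: (spectral_radius_tile_measures_invariant hA' hS' hn T1 cT T0 lS).
by split; split=> // H; [exact/h32/h13|exact/h13/h21].
Qed.
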